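(* Suppose that $\int_0^\infty \sqrt{1-F(x)}\,dx<+\infty$. Then $\gamma(F)<\infty$, and for all $x,t>0$, as $r\to\infty$, $$\frac{\mathbb{E}\, L\big(\mathbf 0,(rx,rt)\big)}{r}\to \gamma(F)\sqrt{xt},$$ and, almost surely, $$\frac{L\big(\mathbf 0,(rx,rt)\big)}{r}\to \gamma(F)\sqrt{xt}.$$
   Context: Let $\mathbf P\subset\mathbb R^2$ be a homogeneous Poisson point process of intensity one, and let $\{\omega_{\mathbf p}:\mathbf p\in\mathbf P\}$ be i.i.d. positive random variables with distribution function $F$, independent of $\mathbf P$. For $\mathbf p\le\mathbf q$ in $\mathbb R^2$ (coordinatewise, $\mathbf p\neq\mathbf q$), $L(\mathbf p,\mathbf q)$ denotes the maximum, over all finite coordinatewise increasing sequences of points of $\mathbf P$ lying in the rectangle $\{\mathbf x: p_1<x_1\le q_1,\ p_2<x_2\le q_2\}$, of the sum of their weights (the empty sum being $0$). Write $\mathbf 0=(0,0)$ and $\gamma(F)=\sup_{n\ge1}\mathbb{E}\,L(\mathbf 0,(n,n))/n$. *)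

(* Defs.v *)
From HB Require Import structures.
From mathcomp Require Import all_boot all_order all_algebra.
From mathcomp Require Import all_classical all_reals all_analysis.
Set Implicit Arguments. Unset Strict Implicit. Unset Printing Implicit Defensive.
Import Order.TTheory GRing.Theory Num.Theory.
Import numFieldNormedType.Exports.
Local Open Scope classical_set_scope.
Local Open Scope ring_scope.

Section LPP.
Variable R : realType.

(* A marked point: ((x1, x2), weight). *)
Definition mpoint := ((R * R) * R)%type.

(* A half-open box ((a1,b1],(a2,b2],(c,d]) in R^2 x R (positions x marks). *)
Definition box := ((R * R) * (R * R) * (R * R))%type.

Definition box_set (B : box) : set mpoint :=
  [set z | B.1.1.1 < z.1.1 <= B.1.1.2 /\ B.1.2.1 < z.1.2 <= B.1.2.2
           /\ B.2.1 < z.2 <= B.2.2].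

Definition box_ok (B : box) : Prop :=
  B.1.1.1 <= B.1.1.2 /\ B.1.2.1 <= B.1.2.2 /\ B.2.1 <= B.2.2.

(* Intensity of the marked process (Lebesgue x dF) of a box. *)
Definition box_mean (F : R -> R) (B : box) : R :=
  (B.1.1.2 - B.1.1.1) * (B.1.2.2 - B.1.2.1) * (F B.2.2 - F B.2.1).

Definition has_card (S : set mpoint) (k : nat) : Prop :=
  exists s : seq mpoint, uniq s /\ size s = k /\ [set` s] = S.

Definition poisson_pmf (m : R) (k : nat) : R :=
  expR (- m) * m ^+ k / (k`!)%:R.

Definition dflt_box : box := ((0, 0), (0, 0), (0, 0)).

Definition positive_cdf (F : R -> R) : Prop :=
  {homo F : x y / x <= y} /\
  (forall a : R, F x @[x --> a^'+] --> F a) /\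
  (F x @[x --> -oo] --> (0 : R)) /\ (F x @[x --> +oo] --> (1 : R)) /\
  F 0 = 0.

(* pts : T -> set mpoint is a Poisson point process on R^2 x R with intensity
   (Lebesgue on R^2) (x) dF, i.e. a rate-one Poisson process on R^2 with
   i.i.d. marks of law F: the numbers of points in pairwise disjoint boxes
   are independent Poisson variables with the right means. *)
Definition marked_PPP d (T : measurableType d) (P : probability T R)
    (F : R -> R) (pts : T -> set mpoint) : Prop :=
  (forall (B : box) (k : nat),
     measurable [set w | has_card (box_set B `&` pts w) k]) /\
  (forall (Bs : seq box) (ks : seq nat),
     size ks = size Bs ->
     (forall i, (i < size Bs)%N -> box_ok (nth dflt_box Bs i)) ->
     (forall i j, (i < j)%N -> (j < size Bs)%N ->
        box_set (nth dflt_box Bs i) `&` box_set (nth dflt_box Bs j) = set0) ->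
     P [set w | forall i, (i < size Bs)%N ->
                  has_card (box_set (nth dflt_box Bs i) `&` pts w) (nth 0%N ks i)]
     = (\prod_(i < size Bs)
          poisson_pmf (box_mean F (nth dflt_box Bs i)) (nth 0%N ks i))%:E).

Definition incr (a b : mpoint) : bool :=
  [&& a.1.1 <= b.1.1, a.1.2 <= b.1.2 & a.1 != b.1].

Definition LPP (pts : set mpoint) (p q : R * R) : \bar R :=
  ereal_sup [set (\sum_(z <- s) z.2)%:E | s in
    [set s : seq mpoint | sorted incr s /\
       forall z, z \in s -> pts z /\ p.1 < z.1.1 <= q.1 /\ p.2 < z.1.2 <= q.2]].

Definition gammaF d (T : measurableType d) (P : probability T R)
    (pts : T -> set mpoint) : \bar R :=
  ereal_sup [set ((\int[P]_w LPP (pts w) (0%R, 0%R) (n%:R%R, n%:R%R)) * (n%:R^-1)%:E)%E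
            | n in [set n : nat | (0 < n)%N]].

End LPP.

(* Main.v *)
Require Import Defs.
From HB Require Import structures.
From mathcomp Require Import all_boot all_order all_algebra.
From mathcomp Require Import all_classical all_reals all_analysis.
From mathcomp Require Import measurable_realfun ring lra zify.
Set Implicit Arguments. Unset Strict Implicit. Unset Printing Implicit Defensive.
Import Order.TTheory GRing.Theory Num.Theory.
Import numFieldNormedType.Exports.
Local Open Scope classical_set_scope.
Local Open Scope ring_scope.

(* The law of a marked Poisson process is determined by the probabilities of the void events
   "no point in a given finite union of boxes": they form a pi-system generating the
   sigma-algebra of configurations. Cutting unions of boxes into disjoint boxes shows that the law is
   invariant under translations and area-preserving diagonal maps, and that the restrictions
   of the process to disjoint rectangles are independent. The diagonal maps reduce the
   direction (x, t) to the diagonal.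

   Finiteness of gamma: a path sum is at most the sum over j of the number of its points of
   weight > j, and the longest chain of such points in an n * n square has expected length
   O(n sqrt(1 - F j)), since k-chains exist with probability at most
   (n ^ 2 (1 - F j)) ^ k / k! ^ 2. Convergence of the expectations is superadditivity.

   Almost surely, the lower limit is at least gamma by the law of large numbers for
   independent blocks on the diagonal. For the upper limit G one covers the diagonal greedily
   by blocks on which the rate is nearly G, as in the Katznelson-Weiss proof of the
   subadditive ergodic theorem: superadditivity and stationarity give E (min(G, gamma + 1))
   <= gamma, which together with the lower bound forces G = gamma. *)

(** * Boxes and configurations *)

(** [LPP] allows weak increase and a configuration may be any set of points, so measurability is the
    first obstacle. The argument runs on the space [conf] of all subsets with the sigma-algebra of
    void events, and with [hlpp], whose chains increase strictly in both coordinates and can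
    therefore be tested on grids. Almost surely no two positions share a coordinate; this identifies
    the two functions for all endpoints at once, and integrals of [LPP] are then read off without
    its measurability.

    No second moment of the passage time of a block is bounded, so the law of large numbers is
    applied to indicators of finitely many integer thresholds, for which pairwise independence and
    Chebyshev's inequality suffice.

    The upper limit G is only shown not to increase under the diagonal shift, which is what the
    greedy covering asks; ergodicity is not invoked, because the lower bound already controls G from
    below. Limits are taken along the integers and filled in by monotonicity. *)

Section Boxes.
Variable R : realType.
Implicit Types (B C : box R) (s t : seq (box R)) (S : set (mpoint R)).

Definition ubox s : set (mpoint R) := [set z | exists2 B, B \in s & box_set B z].

Definition disjb B C := `[< box_set B `&` box_set C = set0 >].

Lemma disjbP B C : reflect (box_set B `&` box_set C = set0) (disjb B C).
Proof. exact: asboolP. Qed.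

Definition boxes_ok s := forall B, B \in s -> box_ok B.

Lemma ubox_nil : ubox [::] = set0.
Proof. by apply/seteqP; split => z // [B]; rewrite in_nil. Qed.

Lemma ubox_cons B s : ubox (B :: s) = box_set B `|` ubox s.
Proof.
apply/seteqP; split => z.
  move=> [C]; rewrite in_cons => /orP[/eqP ->|Cs] Cz; first by left.
  by right; exists C.
case=> [Bz|[C Cs Cz]]; first by exists B; rewrite ?mem_head.
by exists C; rewrite // in_cons Cs orbT.
Qed.

Lemma ubox_cat s t : ubox (s ++ t) = ubox s `|` ubox t.
Proof.
elim: s => [|B s IH] /=; first by rewrite ubox_nil set0U.
by rewrite !ubox_cons IH setUA.
Qed.

Lemma allrel_disjb s t : ubox s `&` ubox t = set0 -> allrel disjb s t.
Proof.
move=> st0; apply/allrelP => B C Bs Ct; apply/disjbP; apply/seteqP; split => // z [Bz Cz].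
by rewrite -st0; split; [exists B|exists C].
Qed.

Lemma boxes_ok_cat s t : boxes_ok s -> boxes_ok t -> boxes_ok (s ++ t).
Proof. by move=> sok tok B; rewrite mem_cat => /orP[/sok|/tok]. Qed.

(** Projection onto the interval with ends [p.1 <= p.2]. Clamping the faces of one box into another
    keeps the cut points ordered and, by [le_clamp], does not change which points of the interval
    lie below them. *)
Definition clamp (p : R * R) (x : R) := Num.max p.1 (Num.min p.2 x).

Lemma clamp_bounds (p : R * R) x y : p.1 <= p.2 -> x <= y ->
  p.1 <= clamp p x /\ clamp p x <= clamp p y /\ clamp p y <= p.2.
Proof.
move=> p12 xy; rewrite /clamp; split; first by rewrite le_max lexx.
split; last by rewrite ge_max p12 ge_min lexx.
by rewrite ge_max le_max lexx /= le_max le_min !ge_min lexx xy !orbT.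
Qed.

Lemma le_clamp (p : R * R) x y : p.1 < y <= p.2 -> (y <= clamp p x) = (y <= x).
Proof.
move=> /andP[py yp]; rewrite /clamp le_max le_min yp /=.
by rewrite [y <= p.1]leNgt py.
Qed.

(** Guillotine cuts along the clamped faces of [B]: two slabs of [C] beyond [B] along the first
    axis, two along the second inside the remaining slab, then two along the third. Half-open sides
    make the pieces fit exactly; a piece may be empty, as [box_ok] allows equal ends. *)
Lemma box_diff C B : box_ok C -> box_ok B -> exists t,
  [/\ boxes_ok t, pairwise disjb t & ubox t = box_set C `\` box_set B].
Proof.
case: C => -[[a1 b1] [a2 b2]] [a3 b3]; case: B => -[[c1 d1] [c2 d2]] [c3 d3].
rewrite /box_ok /= => -[ab1 [ab2 ab3]] [cd1 [cd2 cd3]].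
have [] := @clamp_bounds (a1, b1) _ _ ab1 cd1; rewrite /=.
have [] := @clamp_bounds (a2, b2) _ _ ab2 cd2; rewrite /=.
have [] := @clamp_bounds (a3, b3) _ _ ab3 cd3; rewrite /=.
have := @le_clamp (a1, b1) c1; have := @le_clamp (a1, b1) d1.
have := @le_clamp (a2, b2) c2; have := @le_clamp (a2, b2) d2.
have := @le_clamp (a3, b3) c3; have := @le_clamp (a3, b3) d3.
move: (clamp _ c1) (clamp _ c2) (clamp _ c3) (clamp _ d1) (clamp _ d2) (clamp _ d3).
move=> l1 l2 l3 r1 r2 r3 /= er3 el3 er2 el2 er1 el1 h31 [h32 h33] h21 [h22 h23] h11 [h12 h13].
exists [:: ((a1, l1), (a2, b2), (a3, b3)); ((r1, b1), (a2, b2), (a3, b3));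
  ((l1, r1), (a2, l2), (a3, b3)); ((l1, r1), (r2, b2), (a3, b3));
  ((l1, r1), (l2, r2), (a3, l3)); ((l1, r1), (l2, r2), (r3, b3))].
split.
- by move=> B; rewrite !inE => /or4P[/eqP->|/eqP->|/eqP->|/or3P[/eqP->|/eqP->|/eqP->]].
- have dj D E : box_set D `&` box_set E = set0 -> disjb D E by move/disjbP.
  move: disjb dj => r dj; rewrite /= !andbT; do ![apply/andP; split] => //;
    (apply: dj; apply/seteqP; split => // -[[z1 z2] z3]; rewrite /box_set /=;
     move=> [[/andP[? ?] [/andP[? ?] /andP[? ?]]] [/andP[? ?] [/andP[? ?] /andP[? ?]]]];
     lra).
- rewrite !ubox_cons ubox_nil setU0; apply/seteqP; split => -[[z1 z2] z3]; rewrite /box_set /=.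
    have aux : (a1 < z1 <= b1) -> (a2 < z2 <= b2) -> (a3 < z3 <= b3) ->
       ((z1 <= l1) \/ (r1 < z1)) \/ ((z2 <= l2) \/ (r2 < z2)) \/ ((z3 <= l3) \/ (r3 < z3)) ->
       (a1 < z1 <= b1 /\ a2 < z2 <= b2 /\ a3 < z3 <= b3) /\
       ~ (c1 < z1 <= d1 /\ c2 < z2 <= d2 /\ c3 < z3 <= d3).
      move=> i1 i2 i3 H; split => // -[/andP[u1 v1] [/andP[u2 v2] /andP[u3 v3]]].
      by case: H => [[]|[[]|[]]]; apply/negP;
        rewrite ?el1 ?el2 ?el3 // -?ltNge // -?leNgt ?er1 ?er2 ?er3.
    have sub (a b c d x : R) : a <= c -> d <= b -> c < x <= d -> a < x <= b.
      by move=> ac db /andP[cx xd]; rewrite (le_lt_trans ac cx) (le_trans xd db).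
    have ar1 := le_trans h11 h12; have lb1 := le_trans h12 h13.
    have ar2 := le_trans h21 h22; have lb2 := le_trans h22 h23.
    have ar3 := le_trans h31 h32; have lb3 := le_trans h32 h33.
    by case=> [|[|[|[|[|]]]]] [i1 [i2 i3]]; apply: aux; (apply: sub i1 || apply: sub i2 ||
      apply: sub i3 || (case/andP: i1 => _ _; case/andP: i2 => ? ?;
        case/andP: i3 => ? ?; tauto) || (case/andP: i1; tauto)) => //.
  move=> [[i1 [i2 i3]] nB].
  have := el1 _ i1; have := er1 _ i1; have := el2 _ i2; have := er2 _ i2.
  have := el3 _ i3; have := er3 _ i3.
  move: i1 i2 i3 => /andP[-> ->] /andP[-> ->] /andP[-> ->]; rewrite !andbT.
  move=> f3 e3 f2 e2 f1 e1.
  have [k1|k1] := leP z1 l1; first by left.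
  have [k1'|k1'] := leP z1 r1; last by right; left.
  have [k2|k2] := leP z2 l2; first by right; right; left.
  have [k2'|k2'] := leP z2 r2; last by right; right; right; left.
  have [k3|k3] := leP z3 l3; first by do 4 right; left.
  have [k3'|k3'] := leP z3 r3; last by do 5 right.
  exfalso; apply: nB.
  by rewrite !ltNge -e1 -e2 -e3 -f1 -f2 -f3 k1' k2' k3' -!ltNge k1 k2 k3.
Qed.

Lemma boxes_diff t B : boxes_ok t -> pairwise disjb t -> box_ok B -> exists t',
  [/\ boxes_ok t', pairwise disjb t' & ubox t' = ubox t `\` box_set B].
Proof.
elim: t => [|C t IH] tok td Bok.
  by exists [::]; split => //; rewrite ubox_nil set0D.
move: td => /= /andP[Ct td].
have [t1 [ok1 d1 u1]] := @box_diff C B (tok _ (mem_head _ _)) Bok.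
have [|t2 [ok2 d2 u2]] := IH _ td Bok.
  by move=> D Dt; apply: tok; rewrite in_cons Dt orbT.
exists (t1 ++ t2); split; first exact: boxes_ok_cat.
  rewrite pairwise_cat d1 d2 !andbT; apply: allrel_disjb; rewrite u1 u2.
  apply/seteqP; split => // z [[Cz _] [[D Dt Dz] _]].
  by move/allP : Ct => /(_ _ Dt)/disjbP <-.
by rewrite ubox_cat u1 u2 ubox_cons setDUl.
Qed.

(** The new box is kept whole and subtracted from the pieces found so far; a box violating [box_ok]
    is empty and is dropped. Void probabilities of arbitrary finite unions thus reduce to those of
    disjoint boxes. *)
Lemma disjointify s : exists t,
  [/\ boxes_ok t, pairwise disjb t & ubox t = ubox s].
Proof.
elim: s => [|B s [t [tok td ut]]]; first by exists [::].
have [Bok|nB] := pselect (box_ok B); last first.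
  exists t; split => //; rewrite ubox_cons ut.
  suff -> : box_set B = set0 by rewrite set0U.
  apply/seteqP; split => // z [/andP[? ?] [/andP[? ?] /andP[? ?]]].
  by apply: nB; split; [|split]; lra.
have [t' [ok' d' u']] := @boxes_diff t B tok td Bok.
exists (B :: t'); split.
- by move=> C; rewrite in_cons => /orP[/eqP ->//|/ok'].
- have := @allrel_disjb [:: B] t'; rewrite allrel1l /= d' andbT; apply.
  rewrite ubox_cons ubox_nil setU0 u'; apply/seteqP; split => // z [? [_ ?]]//.
- by rewrite ubox_cons u' ubox_cons -ut setDE setUIr setUCr setIT.
Qed.

Definition aff (k : (R * R) * (R * R)) (x : R * R) : R * R :=
  (k.1.1 * x.1 + k.2.1, k.1.2 * x.2 + k.2.2).

(** The preimage of the configuration, so that passage times of [tconf k S] between [p] and [q] are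
    those of [S] between [aff k p] and [aff k q]. *)
Definition tconf k S : set (mpoint R) := [set z | S (aff k z.1, z.2)].

Definition tbox (k : (R * R) * (R * R)) B : box R :=
  let p := aff k (B.1.1.1, B.1.2.1) in let q := aff k (B.1.1.2, B.1.2.2) in
  ((p.1, q.1), (p.2, q.2), B.2).

Definition resconf (p q : R * R) S : set (mpoint R) :=
  [set z | S z /\ p.1 < z.1.1 <= q.1 /\ p.2 < z.1.2 <= q.2].

(** The ends cross when the box misses the rectangle; the result is then empty and not [box_ok],
    which [disjointify] tolerates. *)
Definition rbox (p q : R * R) B : box R :=
  ((Num.max p.1 B.1.1.1, Num.min q.1 B.1.1.2),
   (Num.max p.2 B.1.2.1, Num.min q.2 B.1.2.2), B.2).

Definition void s : set (set (mpoint R)) := [set S | ubox s `&` S = set0].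

Lemma void_cat s t : void (s ++ t) = void s `&` void t.
Proof.
apply/seteqP; rewrite /void; split => S /=; rewrite ubox_cat setIUl.
  move=> H; have sub0 (X : set (mpoint R)) : X `<=` set0 -> X = set0.
    by move=> ?; apply/seteqP; split.
  by split; apply: sub0; rewrite -H; [exact: subsetUl|exact: subsetUr].
by move=> [-> ->]; rewrite setU0.
Qed.

Lemma voidP s S : void s S <-> forall B, B \in s -> box_set B `&` S = set0.
Proof.
split => [sS B Bs|H]; apply/seteqP; split => // z.
  by move=> [Bz Sz]; rewrite -sS; split => //; exists B.
by move=> [[B Bs Bz] Sz]; rewrite -(H B).
Qed.

Lemma box_setP B (z : mpoint R) : box_set B z <->
  [/\ B.1.1.1 < z.1.1 <= B.1.1.2, B.1.2.1 < z.1.2 <= B.1.2.2 & B.2.1 < z.2 <= B.2.2].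
Proof. by split => [[? []]|[]]. Qed.

Lemma box_set_rbox p q B : box_set (rbox p q B) = resconf p q (box_set B).
Proof.
apply/seteqP; split => -[[z1 z2] z3]; rewrite /box_set /resconf /rbox /=.
  rewrite !gt_max !le_min => -[] /andP[/andP[-> ->] /andP[-> ->]].
  by move=> [/andP[/andP[-> ->] /andP[-> ->]] ->].
rewrite !gt_max !le_min => -[[/andP[-> ->] [/andP[-> ->] ->]]].
by move=> [/andP[-> ->] /andP[-> ->]].
Qed.

Lemma resconf_ubox p q s : ubox (map (rbox p q) s) = resconf p q (ubox s).
Proof.
elim: s => [|B s IH] /=.
  by rewrite ubox_nil; apply/seteqP; split => z // -[].
rewrite !ubox_cons IH box_set_rbox; apply/seteqP; split => z.
  by move=> [[? ?]|[? ?]]; split => //; [left|right].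
by move=> [[?|?] ?]; [left|right].
Qed.

Lemma void_resconf p q s : resconf p q @^-1` void s = void (map (rbox p q) s).
Proof.
apply/seteqP; rewrite /void resconf_ubox; split => S /= H;
  apply/seteqP; split => // z.
  by move=> [[? ?] ?]; rewrite -H.
by move=> [? [? ?]]; rewrite -H.
Qed.

Section affine.
Variable k : (R * R) * (R * R).
Hypotheses (k1 : 0 < k.1.1) (k2 : 0 < k.1.2).

Lemma aff_lt1 (x y : R * R) : ((aff k x).1 < (aff k y).1) = (x.1 < y.1).
Proof. by rewrite /= ltrD2r ltr_pM2l. Qed.
Lemma aff_lt2 (x y : R * R) : ((aff k x).2 < (aff k y).2) = (x.2 < y.2).
Proof. by rewrite /= ltrD2r ltr_pM2l. Qed.

Definition affI (x : R * R) : R * R :=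
  ((x.1 - k.2.1) / k.1.1, (x.2 - k.2.2) / k.1.2).

Lemma affIK x : aff k (affI x) = x.
Proof.
by case: x => a b; rewrite /aff /affI /=; congr (_, _); field; rewrite gt_eqF.
Qed.

Lemma box_set_tbox B z : box_set (tbox k B) (aff k z.1, z.2) <-> box_set B z.
Proof.
rewrite !box_setP [aff k z.1]surjective_pairing /=.
by rewrite !ltrD2r !lerD2r !ltr_pM2l// !ler_pM2l.
Qed.

Lemma tconf_tbox B : tconf k (box_set (tbox k B)) = box_set B.
Proof. by apply/seteqP; split => z /box_set_tbox. Qed.

Lemma tconf_ubox s : tconf k (ubox (map (tbox k) s)) = ubox s.
Proof.
elim: s => [|B s IH] /=; first by rewrite !ubox_nil.
by rewrite !ubox_cons -IH -[in RHS]tconf_tbox.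
Qed.

Lemma tconf_inj S S' : tconf k S = tconf k S' -> S = S'.
Proof.
move=> E; apply/seteqP; split => z Sz.
  suff : tconf k S' (affI z.1, z.2) by rewrite /tconf /= affIK -surjective_pairing.
  by rewrite -E /tconf /= affIK -surjective_pairing.
suff : tconf k S (affI z.1, z.2) by rewrite /tconf /= affIK -surjective_pairing.
by rewrite E /tconf /= affIK -surjective_pairing.
Qed.

Lemma void_tconf s : tconf k @^-1` void s = void (map (tbox k) s).
Proof.
apply/seteqP; split => S; rewrite /void /=.
  move=> H; apply: tconf_inj.
  by rewrite -[LHS]/(tconf k (ubox (map (tbox k) s)) `&` tconf k S) tconf_ubox H.
by move=> H; rewrite -[in LHS]tconf_ubox -[LHS]/(tconf k (ubox (map (tbox k) s) `&` S)) H.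
Qed.

Lemma tbox_ok B : box_ok B -> box_ok (tbox k B).
Proof. by rewrite /box_ok /= !lerD2r !ler_pM2l//. Qed.

Lemma pairwise_tbox s : pairwise disjb s -> pairwise disjb (map (tbox k) s).
Proof.
rewrite pairwise_map; apply: sub_pairwise => B C /disjbP H; apply/disjbP.
apply: tconf_inj; rewrite -[RHS]/set0 -H.
by rewrite -[LHS]/(tconf k (box_set (tbox k B)) `&` tconf k (box_set (tbox k C))) !tconf_tbox.
Qed.

Lemma box_mean_tbox F B : k.1.1 * k.1.2 = 1 -> box_mean F (tbox k B) = box_mean F B.
Proof.
rewrite /box_mean /= => k12; set m := F _ - _.
by rewrite -[RHS]mul1r -k12; ring.
Qed.

End affine.

End Boxes.

(** * Last passage times along strictly increasing chains *)

Section StrictLPP.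
Variable R : realType.
Implicit Types (S : set (mpoint R)) (p q r : R * R) (z : mpoint R) (s : seq (mpoint R)).

Definition sincr (a b : mpoint R) : bool := (a.1.1 < b.1.1) && (a.1.2 < b.1.2).

Lemma sincr_trans : transitive sincr.
Proof.
by move=> b a c /andP[ab1 ab2] /andP[bc1 bc2]; rewrite /sincr (lt_trans ab1) ?(lt_trans ab2).
Qed.

Definition rect p q : set (R * R) := [set x | p.1 < x.1 <= q.1 /\ p.2 < x.2 <= q.2].

Lemma rect_sub p q p' q' : p'.1 <= p.1 -> p'.2 <= p.2 -> q.1 <= q'.1 -> q.2 <= q'.2 ->
  rect p q `<=` rect p' q'.
Proof. by move=> p1 p2 q1 q2 x [/andP[? ?] /andP[? ?]]; split; apply/andP; split; lra. Qed.

Definition schain S p q : set (seq (mpoint R)) :=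
  [set s | sorted sincr s /\ forall z, z \in s -> S z /\ rect p q z.1].

(* With both coordinates strictly increasing, [{hlpp > a}] is a countable union of finite
   intersections of events "this box contains a point"; it is therefore measurable without
   any local finiteness, and [hlpp = LPP] as soon as no two points share a coordinate. *)
Definition hlpp S p q : \bar R :=
  ereal_sup [set (\sum_(z <- s) z.2)%:E | s in schain S p q].

Lemma le_hlpp S p q s : schain S p q s -> ((\sum_(z <- s) z.2)%:E <= hlpp S p q)%E.
Proof. by move=> ss; apply: ereal_sup_ubound; exists s. Qed.

Lemma hlpp_le S p q (y : \bar R) :
  (forall s, schain S p q s -> ((\sum_(z <- s) z.2)%:E <= y)%E) -> (hlpp S p q <= y)%E.
Proof. by move=> H; apply: ge_ereal_sup => _ [s ss <-]; exact: H. Qed.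

Lemma hlpp_ge0 S p q : (0 <= hlpp S p q)%E.
Proof. by have := @le_hlpp S p q [::]; rewrite big_nil; apply; split. Qed.

Lemma hlpp_sub S S' p q p' q' :
  (forall z, S z -> rect p q z.1 -> S' z /\ rect p' q' z.1) ->
  (hlpp S p q <= hlpp S' p' q')%E.
Proof.
move=> H; apply: hlpp_le => s [ss sS]; apply: le_hlpp; split => // z zs.
by have [Sz rz] := sS _ zs; exact: H.
Qed.

Lemma hlpp_mono S p q p' q' :
  p'.1 <= p.1 -> p'.2 <= p.2 -> q.1 <= q'.1 -> q.2 <= q'.2 ->
  (hlpp S p q <= hlpp S p' q')%E.
Proof. by move=> *; apply: hlpp_sub => z Sz rz; split => //; apply: rect_sub rz. Qed.

(** Chains concatenate: points of the first rectangle are at most [q] and those of the second exceed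
    [q] in both coordinates, by the half-open sides. An infinite right-hand side is split off
    because each supremum is reached by moving a finite term across the inequality. *)
Lemma hlpp_superadd S p q r :
  p.1 <= q.1 -> p.2 <= q.2 -> q.1 <= r.1 -> q.2 <= r.2 ->
  (hlpp S p q + hlpp S q r <= hlpp S p r)%E.
Proof.
move=> pq1 pq2 qr1 qr2.
have key s t : schain S p q s -> schain S q r t -> schain S p r (s ++ t).
  move=> [ss sS] [st tS]; split; last first.
    move=> z; rewrite mem_cat => /orP[/sS|/tS] [Sz rz]; split => //;
      by apply: rect_sub rz.
  rewrite sorted_pairwise; last exact: sincr_trans.
  rewrite pairwise_cat -!sorted_pairwise ?ss ?st; [|exact: sincr_trans..].
  rewrite !andbT; apply/allrelP => z z' /sS[_ [/andP[_ z1] /andP[_ z2]]].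
  move=> /tS[_ [/andP[z1' _] /andP[z2' _]]].
  by rewrite /sincr (le_lt_trans z1 z1') (le_lt_trans z2 z2').
have [->|fin] := eqVneq (hlpp S p r) +oo%E; first exact: leey.
have finr (x : \bar R) : (0 <= x)%E -> (x <= hlpp S p r)%E -> x \is a fin_num.
  move=> x0 xle; rewrite ge0_fin_numE//; apply: le_lt_trans xle _.
  by rewrite lt_neqAle fin leey.
have f1 : hlpp S p q \is a fin_num.
  by apply: finr; [exact: hlpp_ge0|exact: hlpp_mono].
rewrite addeC -leeBrDr//; apply: hlpp_le => t ct.
rewrite leeBrDr// addeC -leeBrDr//; apply: hlpp_le => s cs; rewrite leeBrDr// -EFinD.
by rewrite -big_cat; apply: le_hlpp; exact: key.
Qed.

Lemma hlpp_tconf (k : (R * R) * (R * R)) S p q : 0 < k.1.1 -> 0 < k.1.2 ->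
  hlpp (tconf k S) p q = hlpp S (aff k p) (aff k q).
Proof.
move=> k1 k2; apply/eqP; rewrite eq_le; apply/andP; split.
  apply: hlpp_le => s [ss sS].
  have -> : \sum_(z <- s) z.2 = \sum_(z <- [seq (aff k z.1, z.2) | z <- s]) z.2.
    by rewrite big_map.
  apply: le_hlpp; split; last first.
    move=> _ /mapP[z /sS [Sz [r1 r2]] ->]; split => //.
    by rewrite /rect /= !ltrD2r !lerD2r !ltr_pM2l// !ler_pM2l.
  rewrite sorted_map; apply: sub_sorted ss => a b /andP[a1 a2].
  by rewrite /sincr /= !ltrD2r !ltr_pM2l// a1.
apply: hlpp_le => s [ss sS].
have -> : \sum_(z <- s) z.2 = \sum_(z <- [seq (affI k z.1, z.2) | z <- s]) z.2.
  by rewrite big_map.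
have E x : x = aff k (affI k x) by rewrite affIK.
apply: le_hlpp; split; last first.
  move=> _ /mapP[z /sS [Sz rz] ->]; rewrite /tconf /= affIK// -surjective_pairing; split => //.
  by move: rz; rewrite [in rect _ _ z.1](E z.1) /rect /= !ltrD2r !lerD2r !ltr_pM2l// !ler_pM2l.
rewrite sorted_map; apply: sub_sorted ss => a b; rewrite /sincr.
by rewrite [a.1]E [b.1]E !aff_lt1 ?aff_lt2//; rewrite -!E.
Qed.

Lemma hlpp_resconf S p q p' q' :
  p'.1 <= p.1 -> p'.2 <= p.2 -> q.1 <= q'.1 -> q.2 <= q'.2 ->
  hlpp (resconf p' q' S) p q = hlpp S p q.
Proof.
move=> p1 p2 q1 q2; apply/eqP; rewrite eq_le; apply/andP; split; apply: hlpp_sub => z.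
  by move=> [? _].
move=> Sz rz; split => //; split => //.
by have [? ?] := rect_sub p1 p2 q1 q2 rz.
Qed.

(** Consecutive points of an [incr] chain have different positions; without shared coordinates their
    weak inequalities are strict. Several marks at one position do no harm. *)
Lemma LPP_hlpp S p q :
  (forall z z', S z -> S z' -> z.1 != z'.1 -> z.1.1 != z'.1.1 /\ z.1.2 != z'.1.2) ->
  LPP S p q = hlpp S p q.
Proof.
move=> noties; apply/eqP; rewrite eq_le; apply/andP; split.
  apply: ge_ereal_sup => _ [s [ss sS] <-]; apply: le_hlpp; split => //.
  have: all [pred z | `[< S z >]] s by apply/allP => z /sS[Sz _]; exact/asboolP.
  move=> allS; apply: (sub_in_sorted _ allS ss) => a b /asboolP Sa /asboolP Sb.
  move=> /and3P[ab1 ab2 nab]; have [n1 n2] := noties a b Sa Sb nab.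
  by rewrite /sincr !lt_neqAle n1 n2 ab1.
apply: hlpp_le => s [ss sS]; apply: ereal_sup_ubound; exists s => //; split => //.
apply: sub_sorted ss => a b /andP[ab1 ab2]; rewrite /incr !ltW//=.
by apply/eqP => E; move: ab1; rewrite E ltxx.
Qed.

Definition tick (a b : R) (K i : nat) : R := a + (b - a) * (i%:R / K%:R).

Definition cell p q (K : nat) (e : nat * nat) (m : R * R) : box R :=
  ((tick p.1 q.1 K e.1, tick p.1 q.1 K e.1.+1),
   (tick p.2 q.2 K e.2, tick p.2 q.2 K e.2.+1), m).

(** Grid intervals are half-open, so a point of [(a, b]] falls into one of them when [0 < K]; the
    default 0 stands for points elsewhere. *)
Definition cidx (a b : R) (K : nat) (x : R) : nat :=
  xget 0%N [set i | (i < K)%N /\ tick a b K i < x <= tick a b K i.+1].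

Lemma tick0 a b K : tick a b K 0 = a.
Proof. by rewrite /tick mul0r mulr0 addr0. Qed.

Lemma tickK a b K : (0 < K)%N -> tick a b K K = b.
Proof.
by move=> K0; rewrite /tick divff ?mulr1 ?pnatr_eq0 -?lt0n//; lra.
Qed.

Lemma tick_le a b K i j : a <= b -> (i <= j)%N -> tick a b K i <= tick a b K j.
Proof.
move=> ab ij; rewrite lerD2l ler_wpM2l ?subr_ge0//.
by rewrite ler_wpM2r ?invr_ge0// ler_nat.
Qed.

Lemma cidxP a b K x : (0 < K)%N -> a < x <= b ->
  (cidx a b K x < K)%N /\ tick a b K (cidx a b K x) < x <= tick a b K (cidx a b K x).+1.
Proof.
move=> K0 /andP[ax xb]; rewrite /cidx; case: xgetP => [i _ //|noi].
exfalso; have H i : (i <= K)%N -> tick a b K i < x.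
  elim: i => [_|i IH iK]; first by rewrite tick0.
  rewrite ltNge; apply/negP => xi; apply: (noi i); split => //.
  by rewrite xi andbT IH// ltnW.
by have := H K (leqnn K); rewrite tickK// ltNge xb.
Qed.

Definition cinc (e e' : nat * nat) : bool := (e.1 < e'.1)%N && (e.2 < e'.2)%N.

Definition gap (d : R) (a b : mpoint R) : bool :=
  (a.1.1 + d < b.1.1) && (a.1.2 + d < b.1.2).

(** A finite chain has finitely many gaps, so some [d > 0] lies below all of them; halving makes the
    inequality strict. *)
Lemma sincr_gap s : sorted sincr s -> exists2 d, 0 < d & sorted (gap d) s.
Proof.
have gap_le d d' : d' <= d -> subrel (gap d) (gap d').
  move=> dd a b /andP[a1 a2]; rewrite /gap.
  by rewrite (le_lt_trans _ a1) ?lerD2l// (le_lt_trans _ a2) ?lerD2l.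
elim: s => [_|a [_ _|b s IH]]; [by exists 1|by exists 1|].
move=> /andP[/andP[ab1 ab2] /IH [d d0 ds]].
pose m := Num.min d (Num.min ((b.1.1 - a.1.1) / 2) ((b.1.2 - a.1.2) / 2)).
exists m; first by rewrite !lt_min d0 /=; apply/andP; split; lra.
apply/andP; split; last by apply: sub_sorted ds; apply: gap_le; rewrite ge_min lexx.
have h1 : m <= (b.1.1 - a.1.1) / 2 by rewrite !ge_min lexx !orbT.
have h2 : m <= (b.1.2 - a.1.2) / 2 by rewrite !ge_min lexx !orbT.
by rewrite /gap; apply/andP; split; lra.
Qed.

Definition cel p q K z : nat * nat := (cidx p.1 q.1 K z.1.1, cidx p.2 q.2 K z.1.2).

Lemma cidx_lt a b K x y d : (0 < K)%N -> a < x <= b -> a < y <= b ->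
  (b - a) / K%:R <= d -> x + d < y -> (cidx a b K x < cidx a b K y)%N.
Proof.
move=> K0 xab yab dK xy; rewrite ltnNge; apply/negP => ji.
have [_ /andP[x1 x2]] := cidxP K0 xab.
have [_ /andP[y1 y2]] := cidxP K0 yab.
have ab : a <= b by case/andP: xab => ? ?; lra.
have : tick a b K (cidx a b K y).+1 <= tick a b K (cidx a b K x).+1 by exact: tick_le.
have : tick a b K (cidx a b K x).+1 = tick a b K (cidx a b K x) + (b - a) / K%:R.
  by rewrite /tick -natr1 [(_ + 1) / _]mulrDl mul1r mulrDr addrA.
lra.
Qed.

(** Once both mesh widths are at most the gap [d], consecutive points lie in strictly later columns
    and rows. Having this for all large [K] lets [chain_event] take a lower limit of events. *)
Lemma schain_cells S p q s : schain S p q s ->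
  exists K0, forall K, (K0 <= K)%N -> sorted cinc (map (cel p q K) s).
Proof.
move=> [ss sS]; have [d d0 gs] := sincr_gap ss.
pose w := Num.max `|q.1 - p.1| `|q.2 - p.2|.
exists (Num.Def.archi_bound (w / d)).+1 => K K0.
have K0' : (0 < K)%N by exact: leq_trans K0.
have wK : w / K%:R <= d.
  rewrite ler_pdivrMr ?ltr0n// -ler_pdivrMl//  mulrC; apply: ltW.
  apply: (lt_le_trans (archi_boundP _)).
    by rewrite divr_ge0 // ?(ltW d0) // le_max normr_ge0.
  by rewrite ler_nat ltnW.
rewrite sorted_map; have: all [pred z | `[< rect p q z.1 >]] s.
  by apply/allP => z /sS[_ rz]; exact/asboolP.
move=> allS; apply: (sub_in_sorted _ allS gs) => a b /asboolP[a1 a2] /asboolP[b1 b2].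
move=> /andP[ab1 ab2]; rewrite /cinc /cel /=.
rewrite (cidx_lt K0' a1 b1 _ ab1) ?(cidx_lt K0' a2 b2 _ ab2)//;
  apply: le_trans wK; rewrite ler_wpM2r ?invr_ge0//; rewrite (le_trans (ler_norm _))//.
  by rewrite /w le_max lexx orbT.
by rewrite /w le_max lexx.
Qed.

(** The way back from grids to chains: one point picked in each hit cell gives a strict chain whose
    marks are at least the lower ends [e.2.1]. *)
Lemma cells_schain S p q K (c : seq (nat * nat * (R * R))) :
  (0 < K)%N -> p.1 <= q.1 -> p.2 <= q.2 ->
  sorted (fun e e' => cinc e.1 e'.1) c ->
  (forall e, e \in c -> (e.1.1 < K)%N /\ (e.1.2 < K)%N) ->
  (forall e, e \in c -> box_set (cell p q K e.1 e.2) `&` S !=set0) ->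
  ((\sum_(e <- c) e.2.1)%:E <= hlpp S p q)%E.
Proof.
move=> K0 pq1 pq2 sc cK hit.
pose f e : mpoint R := xget (0, 0, 0) (box_set (cell p q K e.1 e.2) `&` S).
have fP e : e \in c -> (box_set (cell p q K e.1 e.2) `&` S) (f e).
  by move=> /hit [z Hz]; exact: (xgetI _ Hz).
apply: (@le_trans _ _ (\sum_(z <- map f c) z.2)%:E).
  rewrite lee_fin big_map big_seq_cond [leRHS]big_seq_cond; apply: ler_sum => e.
  by rewrite andbT => /fP[[_ [_ /andP[/ltW]]]].
apply: le_hlpp; split; last first.
  move=> _ /mapP[e ec ->]; have [[/andP[b1 b2] [/andP[b3 b4] _]] Sz] := fP e ec.
  split => //; have [e1 e2] := cK e ec.
  have := tick_le K pq1 (leq0n e.1.1); have := tick_le K pq2 (leq0n e.1.2).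
  have := tick_le K pq1 e1; have := tick_le K pq2 e2.
  rewrite !tick0 !tickK//; rewrite /cell /= in b1 b2 b3 b4.
  by move=> *; split; apply/andP; split; lra.
rewrite sorted_map; have: all (mem c) c by apply/allP.
move=> allc; apply: (sub_in_sorted _ allc sc) => e e' ec e'c /andP[l1 l2].
have [[/andP[_ b1] [/andP[_ b2] _]] _] := fP e ec.
have [[/andP[b3 _] [/andP[b4 _] _]] _] := fP e' e'c.
rewrite /cell /= in b1 b2 b3 b4.
rewrite /= /sincr (le_lt_trans b1) ?(le_lt_trans b2)//.
  by apply: le_lt_trans b4; exact: tick_le.
by apply: le_lt_trans b3; exact: tick_le.
Qed.

End StrictLPP.

(** * Void events and invariance of the law *)

Section Conf.
Variable R : realType.

Definition voids : set (set (set (mpoint R) : pointedType)) := range (@void R).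
Definition conf : measurableType voids.-sigma := g_sigma_algebraType voids.

Definition hits (s : seq (box R)) : set conf :=
  [set S | forall B, B \in s -> box_set B `&` S !=set0].

Lemma measurable_void s : measurable (void s : set conf).
Proof. by apply: sub_sigma_algebra; exists s. Qed.

Lemma void_nil : void [::] = [set: set (mpoint R)].
Proof. by apply/seteqP; split => // S _; rewrite /void /= ubox_nil set0I. Qed.

Lemma hits_nil : hits [::] = setT.
Proof. by apply/seteqP; split. Qed.

Lemma hits_cons B s : hits (B :: s) = hits s `\` void [:: B].
Proof.
apply/seteqP; split => S.
  move=> H; split; first by move=> C Cs; apply: H; rewrite in_cons Cs orbT.
  move=> /voidP /(_ B (mem_head _ _)) B0.
  by have [z Hz] := H B (mem_head _ _); rewrite B0 in Hz.
move=> [H nv] C; rewrite in_cons => /orP[/eqP -> {C}|]; last exact: H.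
apply/set0P/eqP => B0; apply: nv; apply/voidP => C.
by rewrite mem_seq1 => /eqP ->.
Qed.

Lemma measurable_hits s : measurable (hits s).
Proof.
elim: s => [|B s IH]; first by rewrite hits_nil; exact: measurableT.
by rewrite hits_cons; apply: measurableD => //; exact: measurable_void.
Qed.

Lemma measurable_to_conf d (T : measurableType d) (f : T -> conf) :
  (forall s, measurable (f @^-1` void s)) -> measurable_fun setT f.
Proof.
move=> H; apply: (@measurability _ _ _ conf _ _ voids erefl).
by move=> _ [_ [s _ <-] <-]; rewrite setTI; exact: H.
Qed.

Lemma measurable_tconf (k : (R * R) * (R * R)) : 0 < k.1.1 -> 0 < k.1.2 ->
  measurable_fun setT (tconf k : conf -> conf).
Proof.
move=> k1 k2; apply: measurable_to_conf => s; rewrite void_tconf//.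
exact: measurable_void.
Qed.

Lemma measurable_resconf p q : measurable_fun setT (resconf p q : conf -> conf).
Proof.
by apply: measurable_to_conf => s; rewrite void_resconf; exact: measurable_void.
Qed.

Lemma conf_measure_eq (m1 m2 : measure conf R) :
  (m1 setT < +oo)%E -> (forall s, m1 (void s) = m2 (void s)) ->
  forall A, measurable A -> m1 A = m2 A.
Proof.
move=> fin m12; apply: (@measure_unique _ _ conf voids (fun=> setT) erefl).
- move=> _ _ [s _ <-] [t _ <-]; rewrite -void_cat; by exists (s ++ t).
- by move=> _; exists [::] => //; rewrite void_nil.
- by rewrite bigcup_const.
- by move=> _ [s _ <-].
- by [].
Qed.

(** Countability comes from rounding. A code is a mesh [K] with a finite list of grid cells and
    integer mark levels in units of [1 / K]; it is valid when the cells increase and the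
    rounded-down marks already sum to more than [a]. *)
Lemma measurable_hlpp (p q : R * R) : p.1 <= q.1 -> p.2 <= q.2 ->
  measurable_fun setT (fun S : conf => hlpp S p q).
Proof.
move=> pq1 pq2; apply: (measurability _ (ErealGenOInfty.measurableE R)).
move=> _ [_ [a ->] <-]; rewrite setTI.
pose mk (K : nat) (i : int) : R * R := (i%:~R / K%:R, (i + 1)%:~R / K%:R).
pose code := (nat * seq (nat * nat * int))%type.
pose bx (K : nat) (e : nat * nat * int) := (e.1, mk K e.2).
pose valid (c : code) := [/\ (0 < c.1)%N,
  sorted (fun e e' => cinc e.1 e'.1) (map (bx c.1) c.2),
  forall e, e \in c.2 -> (e.1.1 < c.1)%N /\ (e.1.2 < c.1)%N &
  a < \sum_(e <- map (bx c.1) c.2) e.2.1].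
pose A (c : code) := if `[< valid c >]
  then hits [seq cell p q c.1 e.1 e.2 | e <- map (bx c.1) c.2] else set0.
suff -> : (fun S : conf => hlpp S p q) @^-1` `]a%:E, +oo[ = \bigcup_c A c.
  apply: countable_bigcupT_measurable; first exact: countableP.
  by move=> c; rewrite /A; case: ifP => _; [exact: measurable_hits|exact: measurable0].
apply/seteqP; split => S /=.
  rewrite in_itv /= andbT => /ereal_sup_gt [_ [s ss <-]]; rewrite lte_fin => as_.
  have [K0 HK0] := schain_cells ss.
  pose d := \sum_(z <- s) z.2 - a.
  have d0 : 0 < d by rewrite subr_gt0.
  (* Fine enough for the cells to increase, and for rounding down [size s] marks by at most [1 / K]
     each to cost less than the slack [d]. *)
  pose K := (maxn K0 (Num.Def.archi_bound ((size s)%:R / d))).+1.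
  have sK : (size s)%:R / K%:R < d.
    rewrite ltr_pdivrMr ?ltr0n// -ltr_pdivrMl// mulrC.
    apply: (lt_trans (archi_boundP _)); first by rewrite divr_ge0// ltW.
    by rewrite ltr_nat ltnS leq_maxr.
  (* Ceiling minus one rather than floor, as mark intervals are open on the left. *)
  pose mi (z : mpoint R) : int := Num.ceil (z.2 * K%:R) - 1.
  have miP z : (mk K (mi z)).1 < z.2 <= (mk K (mi z)).2.
    rewrite /mk /= ltr_pdivrMr ?ltr0n// ler_pdivlMr ?ltr0n// /mi.
    by rewrite subrK ceilB1_lt ceil_ge.
  have miP' z : z.2 - K%:R^-1 <= (mk K (mi z)).1.
    have /andP[_] := miP z; rewrite /mk /= intrD mulrDl; lra.
  have [_ sS] := ss.
  exists (K, [seq (cel p q K z, mi z) | z <- s]) => //; rewrite /A asboolT.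
    move=> B /mapP[e]; rewrite -map_comp => /mapP[z zs ->] ->.
    exists z; have [Sz [r1 r2]] := sS _ zs; split => //.
    have [_ c1] := cidxP (ltn0Sn _ : (0 < K)%N) r1.
    have [_ c2] := cidxP (ltn0Sn _ : (0 < K)%N) r2.
    by split; [exact: c1|split; [exact: c2|exact: miP]].
  split => //=.
  - rewrite -map_comp sorted_map; have := HK0 K; rewrite sorted_map.
    by apply; rewrite /K (leq_trans (leq_maxl _ _) (leqnSn _)).
  - move=> e /mapP[z zs ->] /=; have [Sz [r1 r2]] := sS _ zs.
    by split; [have [] := cidxP (ltn0Sn _ : (0 < K)%N) r1|have [] := cidxP (ltn0Sn _ : (0 < K)%N) r2].
  - rewrite -map_comp big_map /=.
    apply: (@lt_le_trans _ _ (\sum_(z <- s) (z.2 - K%:R^-1))).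
      rewrite sumrB; rewrite big_const_seq count_predT iter_addr_0 -mulr_natl.
      by move: sK; rewrite /d; lra.
    by apply: ler_sum => z _; exact: miP'.
move=> [c _]; rewrite /A; case: asboolP => // -[K0 sc cK ac] H.
rewrite in_itv /= andbT; apply: lt_le_trans (@cells_schain _ _ _ _ c.1 (map (bx c.1) c.2) K0 pq1 pq2 sc _ _).
- by rewrite lte_fin.
- by move=> _ /mapP[e ec ->]; exact: cK.
- move=> e ec; apply: H; apply/mapP; by exists e.
Qed.

End Conf.
Arguments hits {R}.

Section Process.
Variables (R : realType) (F : R -> R) (Q : probability (conf R) R).
Hypothesis Fnd : {homo F : x y / x <= y}.
(** Knowledge of the process enters through its void probabilities on disjoint boxes; [law_void]
    supplies them for the marked Poisson process. *)
Hypothesis Qvoid : forall s : seq (box R), boxes_ok s -> pairwise (@disjb R) s ->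
  Q (void s) = (expR (- \sum_(B <- s) box_mean F B))%:E.

Lemma measurable_conf_preimage (f : conf R -> conf R) (A : set (conf R)) :
  measurable_fun setT f -> measurable A -> measurable (f @^-1` A).
Proof. by move=> mf mA; rewrite -[X in measurable X]setTI; exact: mf. Qed.

Lemma Q_tconf (k : (R * R) * (R * R)) (A : set (conf R)) :
  0 < k.1.1 -> 0 < k.1.2 -> k.1.1 * k.1.2 = 1 -> measurable A ->
  Q (tconf k @^-1` A) = Q A.
Proof.
move=> k1 k2 k12 mA.
pose m1 : measure (conf R) R :=
  measure_function_pushforward__canonical__measure_function_Measure Q (measurable_tconf k1 k2).
rewrite -[LHS]/(m1 A); apply: conf_measure_eq => //.
  by rewrite /m1 /= /pushforward preimage_setT probability_setT ltry.
move=> s; rewrite /m1 /= /pushforward void_tconf//.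
have [t [tok td ut]] := disjointify s.
have -> : void s = void t by rewrite /void ut.
have -> : void (map (tbox k) s) = void (map (tbox k) t).
  by rewrite -!void_tconf// /void ut.
rewrite !Qvoid//; last first.
- exact: pairwise_tbox.
- by move=> _ /mapP[B Bt ->]; apply: tbox_ok => //; exact: tok.
by rewrite big_map; under eq_bigr do rewrite box_mean_tbox//.
Qed.

Lemma Q_void_indep s t : ubox s `&` ubox t = set0 ->
  Q (void s `&` void t) = (Q (void s) * Q (void t))%E.
Proof.
move=> st0; have [s' [sok sd us]] := disjointify s; have [t' [tok td ut]] := disjointify t.
have -> : void s = void s' by rewrite /void us.
have -> : void t = void t' by rewrite /void ut.
rewrite -void_cat !Qvoid//; last first.
- by rewrite pairwise_cat sd td !andbT; apply: allrel_disjb; rewrite us ut.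
- exact: boxes_ok_cat.
by rewrite big_cat /= opprD expRD EFinM.
Qed.

(** For a fixed event [V], the restriction of [Q] to [V] and the multiple [Q V] of [Q], both pushed
    forward by [resconf], coincide once they agree on void events. This is used with [V] from the
    second rectangle, then with a void event as [V], which leaves [Q_void_indep]. *)
Lemma Q_indep (p q p' q' : R * R) (A A' : set (conf R)) :
  rect p q `&` rect p' q' = set0 -> measurable A -> measurable A' ->
  Q (resconf p q @^-1` A `&` resconf p' q' @^-1` A') =
  (Q (resconf p q @^-1` A) * Q (resconf p' q' @^-1` A'))%E.
Proof.
move=> disj.
have mr a b (B : set (conf R)) : measurable B -> measurable (resconf a b @^-1` B : set (conf R)).
  by apply: measurable_conf_preimage; exact: measurable_resconf.
have fin (B : set (conf R)) : measurable B -> Q B \is a fin_num.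
  by move=> mB; exact: fin_num_measure.
have push (a b : R * R) (V : set (conf R)) (mV : measurable V) :
    (forall s, Q (resconf a b @^-1` void s `&` V) = (Q (resconf a b @^-1` void s) * Q V)%E) ->
    forall B : set (conf R), measurable B -> Q (resconf a b @^-1` B `&` V) = (Q (resconf a b @^-1` B) * Q V)%E.
  move=> H B mB.
  have V0 : 0 <= fine (Q V) by rewrite fine_ge0.
  pose m1 : measure (conf R) R :=
    measure_function_pushforward__canonical__measure_function_Measure
      (mrestr Q mV) (measurable_resconf a b).
  pose m2 : measure (conf R) R := mscale (NngNum V0)
    (measure_function_pushforward__canonical__measure_function_Measure
      Q (measurable_resconf a b)).
  have e2 (C : set (conf R)) : measurable C -> m2 C = (Q (resconf a b @^-1` C) * Q V)%E.
    by move=> mC; rewrite /m2 /= /mscale /= fineK ?fin// muleC.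
  rewrite -e2// -[LHS]/(m1 B); apply: conf_measure_eq => //.
    rewrite -[m1 _]/(Q (resconf a b @^-1` setT `&` V)); apply: (@le_lt_trans _ _ 1%E); last exact: ltry.
    by apply/probability_le1/measurableI => //; exact: mr.
  by move=> s; rewrite e2; [exact: H|exact: (measurable_void s)].
move=> mA mA'; apply: (push _ _ _ (mr _ _ _ mA')) => // s.
rewrite setIC muleC; apply: (push _ _ _ (mr _ _ _ (measurable_void s))) => // t.
rewrite !void_resconf muleC setIC; rewrite Q_void_indep; last first.
  rewrite !resconf_ubox; apply/seteqP; split => // z [[_ r1] [_ r2]].
  by have : (rect p q `&` rect p' q') z.1 by []; rewrite disj.
by rewrite muleC.
Qed.

Lemma box_mean_ge0 B : box_ok B -> 0 <= box_mean F B.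
Proof. by move=> [b1 [b2 b3]]; rewrite /box_mean !mulr_ge0// subr_ge0// Fnd. Qed.

(** Hitting [B] is the complement of avoiding it, so one subtraction moves [B] from the hit list to
    the void list; the induction therefore carries both lists. *)
Lemma Q_void_hits s1 s2 : boxes_ok (s1 ++ s2) -> pairwise (@disjb R) (s1 ++ s2) ->
  Q (void s1 `&` hits s2) = (expR (- \sum_(B <- s1) box_mean F B) *
    \prod_(B <- s2) (1 - expR (- box_mean F B)))%:E.
Proof.
elim: s2 s1 => [|B s2 IH] s1 ok dj.
  by rewrite hits_nil setIT big_nil mulr1 Qvoid//; move: ok dj; rewrite cats0.
have mI : measurable (void s1 `&` hits s2 : set (conf R)).
  by apply: measurableI; [exact: measurable_void|exact: measurable_hits].
rewrite hits_cons setIDA measureD//; last first.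
- by rewrite (le_lt_trans (probability_le1 _ mI)) ?ltry.
- exact: measurable_void.
have H1 : Q (void s1 `&` hits s2) = (expR (- \sum_(B <- s1) box_mean F B) *
    \prod_(B <- s2) (1 - expR (- box_mean F B)))%:E.
  apply: IH.
    move=> C Cs; apply: ok; move: Cs; rewrite !mem_cat in_cons => /orP[->//|->].
    by rewrite !orbT.
  apply: subseq_pairwise dj; apply: cat_subseq => //; exact: subseq_cons.
have -> : void s1 `&` hits s2 `&` void [:: B] = void (rcons s1 B) `&` hits s2.
  by rewrite -cats1 void_cat -!setIA [void [:: B] `&` _]setIC.
have H2 : Q (void (rcons s1 B) `&` hits s2) =
    (expR (- \sum_(B <- rcons s1 B) box_mean F B) *
    \prod_(B <- s2) (1 - expR (- box_mean F B)))%:E by apply: IH; rewrite cat_rcons.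
transitivity ((expR (- \sum_(B <- s1) box_mean F B) *
      \prod_(B <- s2) (1 - expR (- box_mean F B)))%R%:E -
    (expR (- \sum_(B <- rcons s1 B) box_mean F B) *
      \prod_(B <- s2) (1 - expR (- box_mean F B)))%R%:E)%E.
  by congr (_ - _)%E.
rewrite -EFinB; congr (_%:E); rewrite big_rcons /= opprD expRD [in RHS]big_cons; ring.
Qed.

(** By [1 - exp (- m) <= m] in each factor. This is the form in which independence enters both the
    absence of ties and the bound on long chains. *)
Lemma Q_hits_le s : boxes_ok s -> pairwise (@disjb R) s ->
  (Q (hits s) <= (\prod_(B <- s) box_mean F B)%:E)%E.
Proof.
move=> ok dj; have := @Q_void_hits [::] s ok dj.
rewrite void_nil setTI big_nil oppr0 expR0 mul1r => ->; rewrite lee_fin.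
rewrite big_seq_cond [leRHS]big_seq_cond; apply: ler_prod => B /andP[Bs _].
have m0 : 0 <= box_mean F B by apply: box_mean_ge0; exact: ok.
rewrite subr_ge0 -[X in _ <= X]expR0 ler_expR oppr_le0 m0 /=.
by have := expR_ge1Dx (- box_mean F B); lra.
Qed.

Lemma Q_Boole (I : eqType) (L : seq I) (A : I -> set (conf R)) :
  (forall x, x \in L -> measurable (A x)) ->
  measurable [set S | exists2 x, x \in L & A x S] /\
  (Q [set S | exists2 x, x \in L & A x S] <= \sum_(x <- L) Q (A x))%E.
Proof.
elim: L => [|x L IH] mA.
  have -> : [set S | exists2 x, x \in [::] & A x S] = set0.
    by apply/seteqP; split => S // [x]; rewrite in_nil.
  by split; [exact: measurable0|rewrite measure0 big_nil].
have -> : [set S | exists2 y, y \in x :: L & A y S] =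
    A x `|` [set S | exists2 x, x \in L & A x S].
  apply/seteqP; split => S.
    move=> [y]; rewrite in_cons => /orP[/eqP ->|yL] Ay; first by left.
    by right; exists y.
  by case=> [Ax|[y yL Ay]]; [exists x; rewrite ?mem_head|exists y; rewrite // in_cons yL orbT].
have mx : measurable (A x) by apply: mA; rewrite mem_head.
have [|mL QL] := IH; first by move=> y yL; apply: mA; rewrite in_cons yL orbT.
split; first exact: measurableU.
by rewrite big_cons (le_trans (measureU2 _ mx mL))// leeD2l.
Qed.

End Process.

(** * Numerical bounds on factorials and exponentials *)

Section Numerics.
Variable R : realType.

(** From [exp (-1/2) >= 1/2], hence [exp (1/2) <= 2]. The value 4 matches the powers of 4 in
    [sum_sq_exp_le]. *)
Lemma expR1_le4 : expR 1 <= 4 :> R.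
Proof.
have h : 2^-1 <= expR (- 2^-1) :> R by have := expR_ge1Dx (- 2^-1 : R); lra.
have h2 : expR 2^-1 <= 2 :> R.
  have e : expR 2^-1 * expR (- 2^-1) = 1 :> R by rewrite -expRD subrr expR0.
  have p := expR_gt0 (2^-1 : R); nra.
have -> : (1 : R) = 2^-1 + 2^-1 by lra.
by rewrite expRD; have := expR_gt0 (2^-1 : R); nra.
Qed.

Lemma exprn_fact_le (x : R) n : 0 <= x -> x ^+ n / n`!%:R <= expR x.
Proof.
case: n => [|n] x0; first by rewrite expr0 fact0 divr1; have := expR_ge1Dx x; lra.
by have := expR_ge1Dxn n x0; lra.
Qed.

Lemma sum_half_le n : \sum_(k < n) (2^-1 : R) ^+ k <= 2.
Proof.
suff -> : \sum_(k < n) (2^-1 : R) ^+ k = 2 - 2 * 2^-1 ^+ n.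
  by rewrite gerBl mulr_ge0// exprn_ge0.
elim: n => [|n IH]; first by rewrite big_ord0 expr0 mulr1 subrr.
rewrite big_ord_recr /= IH exprS; lra.
Qed.

Lemma fact_ge_exp2 k : (2 ^ k <= (k.+1)`!)%N.
Proof.
by elim: k => // k IH; rewrite expnS factS leq_mul.
Qed.

(* Beyond [k = 4a] the bound decays geometrically. For [a < 1] this alone would only
   give a constant, and the smallness of [a] comes from the first factor [a]. *)
Lemma sum_sq_exp_le (a : R) (p : nat -> R) n : 0 <= a ->
  (forall k, 0 <= p k <= 1) -> (forall k, p k <= (a ^+ k / k`!%:R) ^+ 2) ->
  \sum_(k < n) p k.+1 <= 7 * a.
Proof.
move=> a0 p01 pa; have [a1|a1] := leP a 1.
  apply: (@le_trans _ _ (\sum_(k < n) a * (2^-1) ^+ k)).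
    apply: ler_sum => k _; apply: le_trans (pa _) _.
    have h1 : 0 <= a ^+ k.+1 <= a.
      by rewrite exprn_ge0//= exprS ler_piMr// exprn_ile1.
    have h2 : 0 <= ((k.+1)`!%:R : R)^-1 <= 2^-1 ^+ k.
      rewrite invr_ge0 ler0n /= exprVn lef_pV2 ?posrE ?exprn_gt0 ?ltr0n ?fact_gt0//.
      by rewrite -natrX ler_nat fact_ge_exp2.
    have h3 : (2^-1 : R) ^+ k <= 1 by rewrite exprn_ile1//; lra.
    rewrite expr2; move: h1 h2 h3; move: (a ^+ _) (_^-1) (_ ^+ k) => x y z.
    move=> /andP[x0 xa] /andP[y0 yz] z1.
    have xy : x * y <= a * z by apply: ler_pM.
    have : x * y <= 1 by rewrite -(mulr1 1); apply: ler_pM => //; lra.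
    have : 0 <= x * y by rewrite mulr_ge0.
    by move: (x * y) xy => w; nra.
  by rewrite -mulr_sumr; have := sum_half_le n; nra.
(* The first [K] terms are at most 1 each and the rest sum to at most 2; with [K <= 4 * a + 1] and
   [a > 1] the total [4 * a + 3] is at most [7 * a]. Taking [K >= 4 * a] lets [4 ^ K] absorb
   [exp (4 * a)]. *)
have [K [K1 K2]] : exists K : nat, 4 * a <= K%:R /\ K%:R <= 4 * a + 1.
  exists (Num.truncn (4 * a)).+1; have a40 : 0 <= 4 * a by lra.
  have /andP[h1 h2] := truncn_itv a40; split; first exact: ltW.
  by rewrite -natr1; lra.
have K0 : (0 < K)%N by rewrite -(ltr0n R); lra.
have pK i : p (K + i)%N <= 2^-1 ^+ i.
  apply: le_trans (pa _) _; set m := (K + i)%N.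
  (* [exprn_fact_le] at [2 * a] instead of [a] leaves the decaying factor [1 / 2 ^ m]. *)
  have h : a ^+ m / m`!%:R <= expR (2 * a) / 2 ^+ m.
    rewrite ler_pdivlMr ?exprn_gt0//.
    by rewrite mulrAC -exprMn [a * 2]mulrC; apply: exprn_fact_le; lra.
  have h' : 0 <= a ^+ m / m`!%:R by rewrite mulr_ge0 ?exprn_ge0// ?invr_ge0.
  apply: (@le_trans _ _ ((expR (2 * a) / 2 ^+ m) ^+ 2)); first by rewrite lerXn2r ?nnegrE// (le_trans h').
  rewrite expr_div_n -expRM_natl -exprM mulnC exprM.
  have -> : (2 : R) ^+ 2 = 4 by rewrite expr2; lra.
  rewrite ler_pdivrMr ?exprn_gt0// /m exprD [leRHS]mulrCA.
  have e1 : expR (2%:R * (2 * a)) <= 4 ^+ K.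
    apply: (@le_trans _ _ (expR (K%:R * 1))); first by rewrite ler_expR; lra.
    by rewrite expRM_natl lerXn2r ?nnegrE// ?expR_ge0// expR1_le4.
  apply: (le_trans e1); rewrite ler_peMr ?exprn_ge0//.
  rewrite -exprMn; have -> : 2^-1 * 4 = 2 :> R by lra.
  by rewrite exprn_ege1//; lra.
apply: (@le_trans _ _ (\sum_(k < K + n) p k.+1)).
  rewrite addnC big_split_ord /= lerDl sumr_ge0// => i _.
  by have /andP[] := p01 (n + i).+1.
rewrite big_split_ord /=.
have s1 : \sum_(i < K) p i.+1 <= K%:R.
  apply: (@le_trans _ _ (\sum_(i < K) 1)).
    by apply: ler_sum => i _; have /andP[] := p01 i.+1.
  by rewrite sumr_const card_ord.
have s2 : \sum_(i < n) p (K + i).+1 <= 2.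
  apply: (le_trans _ (sum_half_le n)); apply: ler_sum => i _.
  rewrite -addnS; apply: (le_trans (pK _)); rewrite exprS.
  by rewrite ler_piMl ?exprn_ge0//; lra.
lra.
Qed.

End Numerics.

(** * Ties *)

Section Ties.
Variables (R : realType) (F : R -> R) (Q : probability (conf R) R).
Hypothesis Fnd : {homo F : x y / x <= y}.
Hypothesis F01 : forall x, 0 <= F x <= 1.
Hypothesis Qvoid : forall s : seq (box R), boxes_ok s -> pairwise (@disjb R) s ->
  Q (void s) = (expR (- \sum_(B <- s) box_mean F B))%:E.

Lemma negligible_small (A : set (conf R)) (C : R) :
  (forall n : nat, exists T : set (conf R),
    [/\ measurable T, A `<=` T & (Q T <= (C / n.+1%:R)%:E)%E]) -> Q.-negligible A.
Proof.
move=> /choice [T HT]; exists (\bigcap_n T n); split.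
- by apply: bigcapT_measurable => n; have [] := HT n.
- apply/eqP; rewrite eq_le measure_ge0 andbT.
  have mT : measurable (\bigcap_n T n) by apply: bigcapT_measurable => n; have [] := HT n.
  have H n : (Q (\bigcap_n T n) <= (C / n.+1%:R)%:E)%E.
    have [mTn _ le] := HT n; apply: le_trans le; apply: le_measure; rewrite ?inE//.
    exact: bigcap_inf.
  have fin : Q (\bigcap_n T n) \is a fin_num by exact: fin_num_measure.
  rewrite -(fineK fin) lee_fin leNgt; apply/negP => x0.
  have := archi_boundP (_ : 0 <= `|C| / fine (Q (\bigcap_n T n))).
  rewrite divr_ge0 ?normr_ge0 ?(ltW x0)// => /(_ isT); rewrite ltr_pdivrMr// => h.
  have := H (Num.Def.archi_bound (`|C| / fine (Q (\bigcap_n T n)))).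
  rewrite -[X in (X <= _)%E](fineK fin) lee_fin ler_pdivlMr ?ltr0n// -natr1.
  have := ler_norm C; lra.
- by move=> S AS n _; have [_ + _] := HT n; apply.
Qed.

(* [b] selects the coordinate in which the tie occurs. *)
Definition coord (b : bool) (z : mpoint R) : R := if b then z.1.1 else z.1.2.
Definition mkbox (b : bool) (i1 i2 m : R * R) : box R :=
  if b then (i1, i2, m) else (i2, i1, m).

Lemma box_set_mkbox b i1 i2 m z : box_set (mkbox b i1 i2 m) z <->
  [/\ i1.1 < coord b z <= i1.2, i2.1 < coord (~~ b) z <= i2.2 & m.1 < z.2 <= m.2].
Proof. by rewrite box_setP; case: b => /=; split => -[? ? ?]; split. Qed.

Lemma box_mean_mkbox b i1 i2 m : box_mean F (mkbox b i1 i2 m) =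
  (i1.2 - i1.1) * (i2.2 - i2.1) * (F m.2 - F m.1).
Proof. by case: b; rewrite /box_mean //= [X in X * _]mulrC. Qed.

(** The level [y] puts the two points into disjoint boxes of one thin strip, where their presence is
    independent. Rational [y] and integral [N] will leave a countable union. *)
Definition tie (b : bool) (y : R) (N : nat) : set (conf R) :=
  [set S | exists z z', [/\ S z, S z', coord b z = coord b z', coord (~~ b) z <= y < coord (~~ b) z' &
    box_set ((- N%:R, N%:R), (- N%:R, N%:R), (- N%:R, N%:R)) z /\
    box_set ((- N%:R, N%:R), (- N%:R, N%:R), (- N%:R, N%:R)) z']].

Lemma tie_negligible b y N : Q.-negligible (tie b y N).
Proof.
have inN (z : mpoint R) b' :
    box_set ((- N%:R, N%:R), (- N%:R, N%:R), (- N%:R, N%:R)) z ->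
    - N%:R < coord b' z <= N%:R /\ - N%:R < z.2 <= N%:R.
  by move=> [? [? ?]]; case: b'.
have [yN|nyN] := boolP (- N%:R <= y <= N%:R); last first.
  apply: (negligibleS _ (negligible_set0 _)) => S [z [z' [_ _ _ /andP[zy yz'] [Nz Nz']]]].
  have [/andP[? ?] _] := inN z (~~ b) Nz; have [/andP[? ?] _] := inN z' (~~ b) Nz'.
  by apply: (negP nyN); apply/andP; split; lra.
have /andP[Ny yN'] := yN.
have N0 : 0 <= N%:R :> R by exact: ler0n.
(* There are [K + 1] strips of width [2 N / (K + 1)]; in each, both boxes are hit with probability
   at most [(4 N^2 / (K + 1))^2]. The sum is [16 N^4 / (K + 1)]. *)
apply: (@negligible_small _ (16 * N%:R ^+ 4)) => K.
have K10 : K.+1%:R != 0 :> R by rewrite pnatr_eq0.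
pose st i := (tick (- N%:R) N%:R K.+1 i, tick (- N%:R) N%:R K.+1 i.+1) : R * R.
pose lo i := mkbox b (st i) (- N%:R, y) (- N%:R, N%:R).
pose hi i := mkbox b (st i) (y, N%:R) (- N%:R, N%:R).
have okst i : (st i).1 <= (st i).2 by apply: tick_le => //; lra.
have stw i : (st i).2 - (st i).1 = 2 * N%:R / K.+1%:R.
  by rewrite /st /tick /= -[i.+1%:R]natr1; move: (K.+1%:R) K10 => k k0; field.
have hb i : (Q (hits [:: lo i; hi i]) <= (16 * N%:R ^+ 4 / K.+1%:R ^+ 2)%:E)%E.
  apply: le_trans (Q_hits_le Fnd Qvoid _ _) _.
  - move=> B; rewrite !inE => /orP[] /eqP ->; have := okst i;
      by rewrite /box_ok /lo /hi /mkbox; case: (b) => /= ?; do !split => //; lra.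
  - rewrite /= !andbT; apply/disjbP/seteqP; split => // z [].
    by move=> /box_set_mkbox[_ /andP[_ /= h] _] /box_set_mkbox[_ /andP[/= h' _] _]; lra.
  rewrite lee_fin !big_cons big_nil mulr1 !box_mean_mkbox stw /=.
  have /andP[f1 f2] := F01 N%:R; have /andP[f3 f4] := F01 (- N%:R).
  have f5 : F (- N%:R) <= F N%:R by apply: Fnd; lra.
  set w := 2 * N%:R / K.+1%:R.
  have w0 : 0 <= w by rewrite !mulr_ge0 ?invr_ge0.
  have -> : 16 * N%:R ^+ 4 / K.+1%:R ^+ 2 = (w * (2 * N%:R) * 1) * (w * (2 * N%:R) * 1).
    by rewrite /w; move: (K.+1%:R) K10 => k k0; field.
  by apply: ler_pM; rewrite ?mulr_ge0//; try lra;
    apply: ler_pM; rewrite ?mulr_ge0//; try lra; apply: ler_wpM2l => //; lra.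
pose A i := hits [:: lo i; hi i].
have [mT QT] := Q_Boole Q (L := iota 0 K.+1) (A := A) (fun i _ => measurable_hits _).
exists [set S | exists2 i, i \in iota 0 K.+1 & A i S]; split => //.
  move=> S [z [z' [Sz Sz' zz' /andP[zy yz'] [Nz Nz']]]].
  have [zb /andP[? ?]] := inN z b Nz.
  have [/andP[? ?] _] := inN z (~~ b) Nz; have [/andP[? ?] /andP[? ?]] := inN z' (~~ b) Nz'.
  have [iK it] := cidxP (ltn0Sn K) zb.
  exists (cidx (- N%:R) N%:R K.+1 (coord b z)); first by rewrite mem_iota.
  move=> B; rewrite !inE => /orP[] /eqP ->; [exists z|exists z']; split => //;
    apply/box_set_mkbox; split => //=; rewrite -?zz'//; apply/andP; split; lra.
apply: (le_trans QT); apply: (@le_trans _ _ (\sum_(i <- iota 0 K.+1) (16 * N%:R ^+ 4 / K.+1%:R ^+ 2)%:E)%E).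
  by apply: lee_sum => i _; exact: hb.
rewrite sumEFin lee_fin big_const_seq count_predT size_iota iter_addr_0 -[leLHS]mulr_natr.
by rewrite le_eqVlt; apply/orP; left; apply/eqP; move: (K.+1%:R) K10 => k k0; field.
Qed.

Definition noties (S : conf R) := forall z z' : mpoint R, S z -> S z' -> z.1 != z'.1 ->
  z.1.1 != z'.1.1 /\ z.1.2 != z'.1.2.

(** Two different positions with one coordinate in common differ in the other, and a rational lies
    between; [pickle] enumerates the choices of coordinate, level and size. *)
Lemma ae_noties : {ae Q, forall S, noties S}.
Proof.
pose T (k : nat) := if unpickle k is Some (b, y, N) then tie b (ratr y) N else set0.
have nT : Q.-negligible (\bigcup_k T k).
  apply: negligible_bigcup => k; rewrite /T; case: unpickle => [[[b y] N]|].
    exact: tie_negligible.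
  exact: negligible_set0.
apply: (negligibleS _ nT) => S nS; apply: contrapT => nTS; apply: nS.
have key b (z z' : mpoint R) : S z -> S z' -> coord b z = coord b z' -> coord (~~ b) z < coord (~~ b) z' -> False.
  move=> Sz Sz' e /rat_in_itvoo [y]; rewrite in_itv /= => /andP[y1 y2].
  pose M := Num.max (Num.max `|z.1.1| (Num.max `|z.1.2| `|z.2|)) (Num.max `|z'.1.1| (Num.max `|z'.1.2| `|z'.2|)).
  pose N := Num.Def.archi_bound M.
  have M0 : 0 <= M by rewrite !le_max normr_ge0.
  have MN : M < N%:R by exact: archi_boundP.
  have aux (x : R) : `|x| <= M -> - N%:R < x <= N%:R.
    by rewrite ler_norml => /andP[? ?]; apply/andP; split; lra.
  apply: nTS; exists (pickle (b, y, N)) => //; rewrite /T pickleK.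
  exists z, z'; split => //; first by rewrite (ltW y1).
  by split; (split; [|split]); apply: aux; rewrite /M !le_max lexx ?orbT.
move=> z z' Sz Sz' zz'.
have sym b (x x' : mpoint R) : S x -> S x' -> coord b x = coord b x' -> coord (~~ b) x = coord (~~ b) x'.
  move=> Sx Sx' e; apply/eqP; rewrite eq_le !leNgt; apply/andP; split; apply/negP.
    exact: key (esym e).
  exact: key e.
split; apply/negP => /eqP E; move/eqP: zz'; apply; rewrite [z.1]surjective_pairing [z'.1]surjective_pairing.
  by have /= := sym true z z' Sz Sz' E => ->; rewrite E.
by have /= := sym false z z' Sz Sz' E => ->; rewrite E.
Qed.

End Ties.

(** * Finiteness of the growth constant *)

Section Chains.
Variables (R : realType) (F : R -> R) (Q : probability (conf R) R).
Hypothesis Fnd : {homo F : x y / x <= y}.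
Hypothesis F01 : forall x, 0 <= F x <= 1.
Hypothesis Qvoid : forall s : seq (box R), boxes_ok s -> pairwise (@disjb R) s ->
  Q (void s) = (expR (- \sum_(B <- s) box_mean F B))%:E.

Lemma cinc_trans : transitive cinc.
Proof.
by move=> b a c /andP[ab1 ab2] /andP[bc1 bc2]; rewrite /cinc (ltn_trans ab1) ?(ltn_trans ab2).
Qed.

Lemma sorted_zip (a b : seq nat) : size a = size b ->
  sorted ltn a -> sorted ltn b -> sorted cinc (zip a b).
Proof.
elim: a b => [|x [|x' a] IH] [|y [|y' b]] //= [sab] /andP[xx' pa] /andP[yy' pb].
by rewrite /cinc /= xx' yy' /=; apply: (IH (y' :: b)) => //=; rewrite sab.
Qed.

Lemma disjb_cells (p q : R * R) K m m' e e' : p.1 <= q.1 -> cinc e e' ->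
  disjb (cell p q K e m) (cell p q K e' m').
Proof.
move=> pq /andP[e1 _]; apply/disjbP/seteqP; split => // z [[/andP[_ h] _] [/andP[h' _] _]].
by have := tick_le K pq e1; move: h h'; rewrite /cell /=; lra.
Qed.

Lemma leq_ffact_exp n k : (n ^_ k <= n ^ k)%N.
Proof.
elim: k => [|k IH]; first by rewrite ffactn0.
by rewrite ffactnSr expnSr leq_mul// leq_subr.
Qed.

(* Union bound over the pairs of increasing [k]-tuples of columns and rows of a [K * K] grid:
   ['C(K, k) ^ 2 * (w / K ^ 2) ^ k <= w ^ k / k! ^ 2] uniformly in the mesh. *)
Lemma chain_event (p q : R * R) (u : R) (k : nat) : p.1 <= q.1 -> p.2 <= q.2 ->
  exists A : set (conf R), [/\ measurable A,
    (Q A <= (((q.1 - p.1) * (q.2 - p.2) * (1 - F u)) ^+ k / k`!%:R ^+ 2)%:E)%E &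
    forall S s, schain S p q s -> size s = k -> (forall z, z \in s -> u < z.2) -> A S].
Proof.
move=> pq1 pq2; set w := (q.1 - p.1) * (q.2 - p.2) * (1 - F u).
have w0 : 0 <= w by have /andP[? ?] := F01 u; rewrite !mulr_ge0// subr_ge0.
pose SS K := [set t : k.-tuple 'I_K | sorted ltn (map val t)]%SET.
pose code K (x : k.-tuple 'I_K * k.-tuple 'I_K) := zip (map val x.1) (map val x.2).
(* The mark window [(u, u + K]] widens with [K] and finally contains the marks of any given
   chain. *)
pose bx K (c : seq (nat * nat)) := [seq cell p q K e (u, u + K%:R) | e <- c].
pose A K x := hits (bx K (@code K x)).
pose L K := enum (finset.setX (SS K) (SS K)).
have codeP K x : x \in L K -> sorted cinc (@code K x) /\ size (@code K x) = k.
  case: x => x1 x2; rewrite mem_enum finset.in_setX !inE => /andP[s1 s2]; split.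
    by apply: sorted_zip => //; rewrite !size_map !size_tuple.
  by rewrite size1_zip ?size_map ?size_tuple.
have meanE K e : (0 < K)%N -> 0 <= box_mean F (cell p q K e (u, u + K%:R)) <= w / K%:R ^+ 2.
  move=> K0; have K0' : K%:R != 0 :> R by rewrite pnatr_eq0 -lt0n.
  have -> : box_mean F (cell p q K e (u, u + K%:R)) =
      (q.1 - p.1) * (q.2 - p.2) * (F (u + K%:R) - F u) / K%:R ^+ 2.
    rewrite /box_mean /cell /tick /= -[e.1.+1%:R]natr1 -[e.2.+1%:R]natr1.
    set a := F (u + _); set b := F u; move: a b => a b.
    by move: (K%:R) K0' => x x0; field.
  have /andP[f1 f2] := F01 u; have /andP[f3 f4] := F01 (u + K%:R).
  have f5 : F u <= F (u + K%:R) by apply: Fnd; rewrite lerDl.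
  have d0 : 0 <= (q.1 - p.1) * (q.2 - p.2) by rewrite mulr_ge0// subr_ge0.
  rewrite /w; apply/andP; split; first by rewrite !mulr_ge0 ?invr_ge0 ?exprn_ge0// subr_ge0.
  by rewrite ler_wpM2r ?invr_ge0 ?exprn_ge0// ler_wpM2l//; lra.
have QA K x : (0 < K)%N -> x \in L K -> (Q (A K x) <= ((w / K%:R ^+ 2) ^+ k)%:E)%E.
  move=> K0 /codeP [sc szc]; apply: le_trans (Q_hits_le Fnd Qvoid _ _) _.
  - move=> _ /mapP[e _ ->]; rewrite /box_ok /= !tick_le//; do !split => //.
    by rewrite lerDl.
  - rewrite pairwise_map; move: sc; rewrite sorted_pairwise; last exact: cinc_trans.
    by apply: sub_pairwise => e e' ee'; exact: disjb_cells.
  rewrite lee_fin big_map -[in leRHS]szc.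
  elim: (code K x) => [|e c IH]; first by rewrite big_nil expr0.
  have /andP[m0 mw] := meanE K e K0.
  rewrite big_cons /= [leRHS]exprS ler_pM//; apply: prodr_ge0 => e' _.
  by have /andP[] := meanE K e' K0.
pose B K := [set S | exists2 x, x \in L K & A K x S].
have [mB QB] : (forall K, measurable (B K)) /\ forall K, (0 < K)%N ->
    (Q (B K) <= (w ^+ k / k`!%:R ^+ 2)%:E)%E.
  split=> [K|K K0]; have [mB QB] := Q_Boole Q (L := L K) (A := A K) (fun x _ => measurable_hits _).
    exact: mB.
  apply: (le_trans QB); apply: (@le_trans _ _ (\sum_(x <- L K) ((w / K%:R ^+ 2) ^+ k)%:E)%E).
    rewrite big_seq_cond [leRHS]big_seq_cond; apply: lee_sum => x /andP[xL _].
    exact: QA.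
  rewrite sumEFin lee_fin big_const_seq count_predT iter_addr_0 -[leLHS]mulr_natr.
  have -> : size (L K) = ('C(K, k) ^ 2)%N.
    by rewrite -cardE cardsX card_ltn_sorted_tuples mulnn.
  have cK : ('C(K, k))%:R * k`!%:R <= K%:R ^+ k :> R.
    by rewrite -natrM -natrX ler_nat bin_ffact leq_ffact_exp.
  rewrite ler_pdivlMr ?exprn_gt0 ?ltr0n ?fact_gt0// expr_div_n natrX.
  have K0' : 0 < K%:R :> R by rewrite ltr0n.
  rewrite -!mulrA ler_piMr ?exprn_ge0// mulrC ler_pdivrMr ?exprn_gt0//.
  rewrite mul1r -exprM mulnC exprM mulrA -expr2 -exprMn.
  by apply: lerXn2r; rewrite ?nnegrE ?exprn_ge0 ?mulr_ge0 ?ler0n.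
(* A given chain is caught by [B K] for all large [K], so the event is the lower limit of the [B K];
   continuity along the increasing sets [D] preserves the uniform bound. The index [K.+1] keeps the
   grid nonempty. *)
pose D K0 : set (conf R) := \bigcap_(K in [set K | (K0 <= K)%N]) B K.+1.
have mD K0 : measurable (D K0) by apply: bigcap_measurable => //; exists K0 => /=.
have mUD : measurable (\bigcup_K0 D K0) by exact: bigcupT_measurable.
exists (\bigcup_K0 D K0); split => //.
  have cv : Q (D n) @[n --> \oo] --> Q (\bigcup_K0 D K0).
    apply: nondecreasing_cvg_mu => // n m nm; apply/subsetPset => S DS K /= mK.
    by apply: DS => /=; exact: leq_trans mK.
  apply: (cvge_le _ cv); apply: nearW => n.
  apply: (le_trans _ (QB n.+1 isT)); apply: le_measure; rewrite ?inE//.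
  by move=> S; apply => /=.
move=> S s ss szs us; have [K0 HK0] := schain_cells ss; have [_ sS] := ss.
have [M HM] : exists M : nat, forall z, z \in s -> z.2 <= u + M%:R.
  elim: (s) => [|z s' [M HM]]; first by exists 0%N.
  exists (maxn M (Num.Def.archi_bound `|z.2 - u|)) => z'; rewrite in_cons => /orP[/eqP ->|/HM h].
    rewrite -lerBlDl; apply: (le_trans (ler_norm _)); apply: ltW; apply: lt_le_trans (archi_boundP _) _ => //.
    by rewrite ler_nat leq_maxr.
  by apply: (le_trans h); rewrite lerD2l ler_nat leq_maxl.
exists (maxn K0 M) => // K /= KK.
have sK := HK0 K.+1 (leq_trans (leq_trans (leq_maxl _ _) KK) (leqnSn _)).
have zK z : z \in s -> (cidx p.1 q.1 K.+1 z.1.1 < K.+1)%N /\ (cidx p.2 q.2 K.+1 z.1.2 < K.+1)%N.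
  by move=> /sS [_ [r1 r2]]; split; [have [] := cidxP (ltn0Sn K) r1|have [] := cidxP (ltn0Sn K) r2].
pose t1 := map_tuple (fun z => inord (cidx p.1 q.1 K.+1 z.1.1) : 'I_K.+1) (in_tuple s).
pose t2 := map_tuple (fun z => inord (cidx p.2 q.2 K.+1 z.1.2) : 'I_K.+1) (in_tuple s).
have e1 : map val t1 = [seq cidx p.1 q.1 K.+1 z.1.1 | z <- s].
  by rewrite /= -map_comp; apply/eq_in_map => z zs /=; rewrite inordK//; have [] := zK z zs.
have e2 : map val t2 = [seq cidx p.2 q.2 K.+1 z.1.2 | z <- s].
  by rewrite /= -map_comp; apply/eq_in_map => z zs /=; rewrite inordK//; have [] := zK z zs.
exists (tcast szs t1, tcast szs t2).
  rewrite mem_enum finset.in_setX !inE !val_tcast e1 e2; apply/andP; split;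
    rewrite sorted_map; move: sK; rewrite sorted_map; apply: sub_sorted => a b /andP[] //.
rewrite /A /code /= !val_tcast e1 e2 zip_map => C /mapP[_ /mapP[z zs ->] ->].
exists z; have [Sz [r1 r2]] := sS z zs; split => //.
have [_ c1] := cidxP (ltn0Sn K) r1; have [_ c2] := cidxP (ltn0Sn K) r2.
split; [exact: c1|split; [exact: c2|]] => /=; rewrite us//=.
apply: (le_trans (HM _ zs)); rewrite lerD2l ler_nat.
by apply: leq_trans (leqnSn _); apply: leq_trans KK; exact: leq_maxr.
Qed.

End Chains.

Definition diag (R : realType) (x : R) : R * R := (x, x).

Section ExpectationBound.
Variables (R : realType) (F : R -> R) (Q : probability (conf R) R).
Hypothesis Fnd : {homo F : x y / x <= y}.
Hypothesis F01 : forall x, 0 <= F x <= 1.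
Hypothesis Qvoid : forall s : seq (box R), boxes_ok s -> pairwise (@disjb R) s ->
  Q (void s) = (expR (- \sum_(B <- s) box_mean F B))%:E.

(** Discrete layer cake: for [x > 0] the sum is the least integer not below [x]. *)
Lemma le_sum_thresholds (x : R) M : x <= M%:R -> x <= \sum_(j < M) (j%:R < x)%R%:R.
Proof.
elim: M => [|M IH]; first by rewrite big_ord0.
move=> xM; rewrite big_ord_recr /=; have [Mx|xM'] := ltP M%:R x; last first.
  by rewrite addr0; exact: IH.
apply: (le_trans xM); rewrite -natr1 lerD2r.
rewrite (eq_bigr (fun=> 1)) ?sumr_const ?card_ord// => j _.
by rewrite (lt_trans _ Mx)// ltr_nat.
Qed.

(** The points of weight above [j] form a subchain, and its first [k + 1] points witness [A j k.+1]
    for each [k] below their number. Summing over [k] counts them, summing over [j] bounds the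
    weights. *)
Lemma hlpp_le_layers (p q : R * R) (A : nat -> nat -> set (conf R)) S :
  (forall j k s, schain S p q s -> size s = k -> (forall z, z \in s -> j%:R < z.2) -> A j k S) ->
  (hlpp S p q <= \sum_(0 <= j <oo) \sum_(0 <= k <oo) (\1_(A j k.+1) S)%:E)%E.
Proof.
move=> HA; apply: hlpp_le => s [ss sS].
have [M HM] : exists M : nat, forall z, z \in s -> z.2 <= M%:R.
  elim: (s) => [|z s' [M HM]]; first by exists 0%N.
  exists (maxn M (Num.Def.archi_bound `|z.2|)) => z'; rewrite in_cons => /orP[/eqP ->|/HM h].
    apply: (le_trans (ler_norm _)); apply: ltW; apply: lt_le_trans (archi_boundP _) _ => //.
    by rewrite ler_nat leq_maxr.
  by apply: (le_trans h); rewrite ler_nat leq_maxl.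
pose c j := count (fun z : mpoint R => j%:R < z.2) s.
have T0 j : (0 <= \sum_(0 <= k <oo) (\1_(A j k.+1) S)%:E :> \bar R)%E.
  by apply: nneseries_ge0 => k _ _; rewrite lee_fin.
have cT j : (((c j)%:R : R)%:E <= \sum_(0 <= k <oo) (\1_(A j k.+1) S)%:E)%E.
  apply: (@le_trans _ _ (\sum_(0 <= k < c j) (\1_(A j k.+1) S)%:E)%E); last first.
    by apply: (@nneseries_lim_ge R (fun k => (\1_(A j k.+1) S)%:E) xpredT) => k _ _; rewrite lee_fin.
  rewrite big_nat (eq_bigr (fun=> 1%:E)); last first.
    move=> k kc; rewrite indicE mem_set//.
    pose s' := take k.+1 [seq z <- s | j%:R < z.2].
    have sub z : z \in s' -> z \in s /\ j%:R < z.2.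
      by move/mem_take; rewrite mem_filter => /andP[].
    apply: (HA j _ s').
    - split; last by move=> z /sub[/sS].
      by apply: take_sorted; apply: sorted_filter => //; exact: sincr_trans.
    - by rewrite size_takel// size_filter.
    - by move=> z /sub[].
  rewrite -big_nat sumEFin lee_fin big_mkord sumr_const card_ord//.
apply: (@le_trans _ _ (\sum_(0 <= j < M) ((c j)%:R : R)%:E)%E); last first.
  apply: (@le_trans _ _ (\sum_(0 <= j < M) \sum_(0 <= k <oo) (\1_(A j k.+1) S)%:E)%E).
    by apply: lee_sum => j _; exact: cT.
  by apply: (@nneseries_lim_ge R (fun j => \sum_(0 <= k <oo) (\1_(A j k.+1) S)%:E)%E xpredT) => j _ _; exact: T0.
rewrite sumEFin lee_fin big_mkord.
apply: (@le_trans _ _ (\sum_(z <- s) \sum_(j < M) (j%:R < z.2)%R%:R)).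
  rewrite big_seq_cond [leRHS]big_seq_cond; apply: ler_sum => z /andP[zs _].
  by apply: le_sum_thresholds; exact: HM.
rewrite exchange_big /=; apply: ler_sum => j _; rewrite /c.
elim: (s) => [|z s' IH]; first by rewrite big_nil.
by rewrite big_cons /= natrD lerD2l.
Qed.

Hypothesis Fsum : (\sum_(0 <= j <oo) (Num.sqrt (1 - F j%:R))%:E < +oo)%E.

(** For each [j] the chain bounds are the squares required by [sum_sq_exp_le] with
    [a = n * sqrt (1 - F j)], which is linear in [n]; [C] is seven times the series of square
    roots. *)
Lemma integral_hlpp_le : exists C : R, forall n : nat,
  (\int[Q]_S hlpp S (diag 0%R) (diag n%:R%R) <= (C * n%:R)%:E)%E.
Proof.
have sq0 j : (0 <= (Num.sqrt (1 - F j%:R))%:E)%E by rewrite lee_fin sqrtr_ge0.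
have fsum : (\sum_(0 <= j <oo) (Num.sqrt (1 - F j%:R))%:E)%E \is a fin_num.
  by rewrite ge0_fin_numE//; apply: nneseries_ge0.
exists (7 * fine (\sum_(0 <= j <oo) (Num.sqrt (1 - F j%:R))%:E)%E) => n.
have n0 : 0 <= n%:R :> R by [].
have /choice[A' HA'] : forall jk : nat * nat, exists A : set (conf R),
    [/\ measurable A,
    (Q A <= (((n%:R - 0) * (n%:R - 0) * (1 - F jk.1%:R)) ^+ jk.2 / jk.2`!%:R ^+ 2)%:E)%E &
    forall S s, schain S (diag 0) (diag n%:R) s -> size s = jk.2 ->
      (forall z, z \in s -> jk.1%:R < z.2) -> A S].
  move=> [j k]; exact: (@chain_event _ _ _ Fnd F01 Qvoid (diag 0) (diag n%:R) j%:R k).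
pose A j k := A' (j, k); have HA j k := HA' (j, k).
have mA j k : measurable (A j k) by have [] := HA j k.
have mf j k : measurable_fun setT (fun S : conf R => (\1_(A j k.+1) S)%:E).
  by apply/measurable_EFinP; exact: measurable_indic.
have f0 j k S : (0 <= (\1_(A j k.+1) S)%:E)%E by rewrite lee_fin.
have mg j : measurable_fun setT (fun S : conf R => \sum_(0 <= k <oo) (\1_(A j k.+1) S)%:E)%E.
  exact: ge0_emeasurable_sum.
apply: (@le_trans _ _ (\int[Q]_S \sum_(0 <= j <oo) \sum_(0 <= k <oo) (\1_(A j k.+1) S)%:E)%E).
  apply: ge0_le_integral => //.
  - by move=> S _; exact: hlpp_ge0.
  - exact: measurable_hlpp.
  - by apply: ge0_emeasurable_sum => // j S _ _; exact: nneseries_ge0.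
  - move=> S _; apply: hlpp_le_layers => j k s sc sk sj.
    by have [_ _ h] := HA j k; exact: h sc sk sj.
rewrite integral_nneseries//; last by move=> j S _; exact: nneseries_ge0.
apply: (@le_trans _ _ (\sum_(0 <= j <oo) (7 * n%:R)%:E * (Num.sqrt (1 - F j%:R))%:E)%E).
  apply: lee_nneseries => j _.
    by move=> _; apply: integral_ge0 => S _; exact: nneseries_ge0.
  rewrite integral_nneseries//.
  apply: lime_le.
    by apply: is_cvg_nneseries => k _ _; apply: integral_ge0.
  apply: nearW => m.
  rewrite (eq_bigr (fun k => (fine (Q (A j k.+1)))%:E)); last first.
    by move=> k _; rewrite integral_indic// setIT fineK// fin_num_measure.
  rewrite sumEFin lee_fin big_mkord -mulrA.
  have /andP[F0 F1] := F01 j%:R.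
  apply: (@sum_sq_exp_le _ _ (fun k => fine (Q (A j k)))).
  - by rewrite mulr_ge0// sqrtr_ge0.
  - move=> k; rewrite fine_ge0//= -lee_fin fineK ?fin_num_measure//.
    exact: probability_le1.
  - move=> k; rewrite -lee_fin fineK ?fin_num_measure//; have [_ h _] := HA j k.
    apply: (le_trans h); rewrite lee_fin /= !subr0.
    have -> : n%:R * n%:R * (1 - F j%:R) = (n%:R * Num.sqrt (1 - F j%:R)) ^+ 2.
      by rewrite exprMn sqr_sqrtr ?subr_ge0// expr2.
    by rewrite expr_div_n -!exprM mulnC.
rewrite nneseriesZl//.
by rewrite -(fineK fsum) -EFinM lee_fin; rewrite mulrAC.
Qed.

End ExpectationBound.

(** * Stationarity and convergence of the expectations *)

Section Interpolation.
Variable R : realType.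

Lemma ereal_squeeze (u : R -> \bar R) (g : R) :
  (forall e, 0 < e -> \forall r \near +oo, ((g - e)%:E <= u r <= (g + e)%:E)%E) ->
  u r @[r --> +oo] --> g%:E.
Proof.
move=> H; apply/fine_cvgP; split.
  near=> r; have /andP[u1 u2] : ((g - 1)%:E <= u r <= (g + 1)%:E)%E.
    by near: r; exact: H.
  by rewrite fin_numE; move: u1 u2; case: (u r).
apply/cvgrPdist_le => e e0; near=> r.
have /andP[] : ((g - e)%:E <= u r <= (g + e)%:E)%E by near: r; exact: H.
rewrite /=; case: (u r) => //= v; rewrite !lee_fin => u1 u2.
by rewrite ler_norml; apply/andP; split; lra.
Unshelve. all: by end_near. Qed.

(** Asked along the integers only; applied both to expectations and to single configurations. *)
Definition lin_growth (h : R -> \bar R) (g : R) := forall e, 0 < e ->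
  exists N : nat, forall n, (N <= n)%N ->
    (((g - e) * n%:R)%:E <= h n%:R <= ((g + e) * n%:R)%:E)%E.

Lemma cvg_lin_growth (h : R -> \bar R) (g : R) : 0 <= g ->
  (forall r s, 0 <= r -> r <= s -> (h r <= h s)%E) -> (0 <= h 0%R)%E ->
  lin_growth h g -> (h r * (r^-1)%:E)%E @[r --> +oo] --> g%:E.
Proof.
move=> g0 hnd h0 H; apply: ereal_squeeze => e e0.
have [N HN] := H _ (divr_gt0 e0 (ltr0Sn _ 1)).
set e2 := e / 2 in HN.
have e20 : 0 < e2 by rewrite divr_gt0.
near=> r.
have r1 : 1 <= r by near: r; apply: nbhs_pinfty_ge; rewrite num_real.
have rN : N%:R + 1 <= r by near: r; apply: nbhs_pinfty_ge; rewrite num_real.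
(* Rounding [r] up to the next integer adds at most [g + e2] to the upper bound; beyond this
   threshold that is at most [e2 * r]. *)
have rg : (g + e2) / e2 <= r by near: r; apply: nbhs_pinfty_ge; rewrite num_real.
have r0 : 0 < r by lra.
have re : g + e2 <= r * e2 by rewrite -ler_pdivrMr.
have /andP[n1 n2] := truncn_itv (ltW r0).
set n := Num.truncn r in n1 n2.
have Nn : (N <= n)%N.
  by rewrite -ltnS -(ltr_nat R); apply: le_lt_trans n2; lra.
have /andP[l1 _] := HN n Nn.
have /andP[_ l2] := HN n.+1 (leq_trans Nn (leqnSn _)).
have hr1 : (h n%:R <= h r)%E by exact: hnd.
have hr2 : (h r <= h n.+1%:R)%E by apply: hnd; lra.
have hr0 : (0 <= h r)%E by apply: (le_trans h0); apply: hnd => //; lra.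
have n3 : n.+1%:R = n%:R + 1 :> R by rewrite natr1.
have up := le_trans hr2 l2; have lo := le_trans l1 hr1.
case: (h r) up lo hr0 => [v| |] up lo v0 //.
rewrite !lee_fin in up lo v0; rewrite -EFinM !lee_fin ler_pdivlMr// ler_pdivrMr//.
have ee : e = e2 + e2 by rewrite /e2; lra.
apply/andP; split.
  have [ge|ge] := leP e2 g; last by apply: le_trans v0; nra.
  by apply: le_trans lo; rewrite n3 in n2; nra.
by apply: (le_trans up); rewrite n3; nra.
Unshelve. all: by end_near. Qed.

End Interpolation.

Section Stationarity.
Variables (R : realType) (F : R -> R) (Q : probability (conf R) R).
Hypothesis Fnd : {homo F : x y / x <= y}.
Hypothesis F01 : forall x, 0 <= F x <= 1.
Hypothesis Qvoid : forall s : seq (box R), boxes_ok s -> pairwise (@disjb R) s ->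
  Q (void s) = (expR (- \sum_(B <- s) box_mean F B))%:E.

Lemma integral_tconf (k : (R * R) * (R * R)) (f : conf R -> \bar R) :
  0 < k.1.1 -> 0 < k.1.2 -> k.1.1 * k.1.2 = 1 ->
  measurable_fun setT f -> (forall S, 0 <= f S)%E ->
  (\int[Q]_S f (tconf k S) = \int[Q]_S f S)%E.
Proof.
move=> k1 k2 k12 mf f0; have mt := measurable_tconf k1 k2.
rewrite -[LHS]/(\int[Q]_(x in tconf k @^-1` setT) (f \o tconf k) x)%E.
rewrite -(@ge0_integral_pushforward _ _ _ (conf R) _ _ mt Q setT f)//.
apply: (@eq_measure_integral _ _ _ _ Q
  (measure_function_pushforward__canonical__measure_function_Measure Q mt)).
by move=> A mA _; rewrite /= /pushforward (Q_tconf Qvoid).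
Qed.

Lemma integral_hlpp_aff (k : (R * R) * (R * R)) (p q : R * R) :
  0 < k.1.1 -> 0 < k.1.2 -> k.1.1 * k.1.2 = 1 -> p.1 <= q.1 -> p.2 <= q.2 ->
  (\int[Q]_S hlpp S (aff k p) (aff k q) = \int[Q]_S hlpp S p q)%E.
Proof.
move=> k1 k2 k12 pq1 pq2.
rewrite -[RHS](integral_tconf k1 k2 k12); last by move=> S; exact: hlpp_ge0.
  by apply: eq_integral => S _; rewrite hlpp_tconf.
exact: measurable_hlpp.
Qed.

Definition translate (a : R) : (R * R) * (R * R) := (diag 1, diag a).

Lemma hlpp_translate a S x y :
  hlpp (tconf (translate a) S) (diag x) (diag y) = hlpp S (diag (x + a)) (diag (y + a)).
Proof. by rewrite hlpp_tconf//= /aff /= !mul1r. Qed.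

Lemma measurable_hlpp_diag (x y : R) : x <= y ->
  measurable_fun setT (fun S : conf R => hlpp S (diag x) (diag y)).
Proof. by move=> xy; exact: measurable_hlpp. Qed.

Definition Ehlpp (x : R) : \bar R := \int[Q]_S hlpp S (diag 0%R) (diag x).

Lemma Ehlpp_shift a x : 0 <= x -> (\int[Q]_S hlpp S (diag a) (diag (x + a)%R) = Ehlpp x)%E.
Proof.
move=> x0; rewrite -[RHS](@integral_tconf (translate a))//= ?mulr1//.
- by apply: eq_integral => S _; rewrite hlpp_translate add0r.
- exact: measurable_hlpp_diag.
- by move=> S; exact: hlpp_ge0.
Qed.

Lemma Ehlpp_ge0 x : (0 <= Ehlpp x)%E.
Proof. by apply: integral_ge0 => S _; exact: hlpp_ge0. Qed.

Lemma Ehlpp_nd x y : 0 <= x -> x <= y -> (Ehlpp x <= Ehlpp y)%E.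
Proof.
move=> x0 xy; apply: ge0_le_integral => //.
- by move=> S _; exact: hlpp_ge0.
- exact: measurable_hlpp_diag.
- by apply: measurable_hlpp_diag; lra.
- by move=> S _; exact: hlpp_mono.
Qed.

Lemma Ehlpp_superadd x y : 0 <= x -> 0 <= y -> (Ehlpp x + Ehlpp y <= Ehlpp (x + y))%E.
Proof.
move=> x0 y0; rewrite -(Ehlpp_shift x y0) /Ehlpp -ge0_integralD//; last first.
- by apply: measurable_hlpp_diag; lra.
- by move=> S _; exact: hlpp_ge0.
- exact: measurable_hlpp_diag.
- by move=> S _; exact: hlpp_ge0.
apply: ge0_le_integral => //.
- by move=> S _; rewrite adde_ge0// hlpp_ge0.
- by apply: emeasurable_funD; apply: measurable_hlpp_diag; lra.
- by apply: measurable_hlpp_diag; lra.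
- by move=> S _; rewrite [(y + x)%R]addrC; apply: hlpp_superadd; rewrite /=; lra.
Qed.

Lemma Ehlpp_mul x n : 0 <= x -> (n%:R%:E * Ehlpp x <= Ehlpp (n%:R * x))%E.
Proof.
move=> x0; elim: n => [|n IH]; first by rewrite mul0e Ehlpp_ge0.
rewrite -natr1 EFinD ge0_muleDl ?lee_fin// mul1e mulrDl mul1r.
apply: (le_trans _ (Ehlpp_superadd _ x0)); last by rewrite mulr_ge0.
exact: leeD2r.
Qed.

Definition gam : \bar R :=
  ereal_sup [set (Ehlpp n%:R * (n%:R^-1)%:E)%E | n in [set n : nat | (0 < n)%N]].

Lemma gam_ge0 : (0 <= gam)%E.
Proof.
apply: (@le_trans _ _ (Ehlpp 1%:R * (1%:R^-1)%:E)%E).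
  by rewrite mule_ge0 ?Ehlpp_ge0// lee_fin invr_ge0.
by apply: ereal_sup_ubound; exists 1%N.
Qed.

Hypothesis Fsum : (\sum_(0 <= j <oo) (Num.sqrt (1 - F j%:R))%:E < +oo)%E.

Lemma gam_fin : gam \is a fin_num.
Proof.
rewrite ge0_fin_numE ?gam_ge0//.
have [C HC] := integral_hlpp_le Fnd F01 Qvoid Fsum.
apply: (@le_lt_trans _ _ C%:E); last exact: ltry.
apply: ge_ereal_sup => _ [n /= n0 <-].
rewrite lee_pdivrMr ?ltr0n//; exact: HC.
Qed.

Lemma Ehlpp_le n : (Ehlpp n%:R <= (fine gam * n%:R)%:E)%E.
Proof.
case: n => [|n].
  rewrite mulr0; have [C HC] := integral_hlpp_le Fnd F01 Qvoid Fsum.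
  by have := HC 0%N; rewrite mulr0.
rewrite EFinM fineK ?gam_fin// -lee_pdivrMr ?ltr0n//.
by apply: ereal_sup_ubound; exists n.+1.
Qed.

(** Fekete's argument: some block length [m] nearly attains the supremum, and a square of side [n]
    contains [n %/ m] such diagonal blocks. The remainder, shorter than [m], costs at most
    [g * m]. *)
Lemma lin_growth_Ehlpp : lin_growth Ehlpp (fine gam).
Proof.
set g := fine gam; have g0 : 0 <= g by rewrite fine_ge0// gam_ge0.
move=> e e0; have e20 : 0 < e / 2 by lra.
have : ((g - e / 2)%:E < gam)%E by rewrite -[gam]fineK ?gam_fin// lte_fin -/g; lra.
move=> /ereal_sup_gt[_ [m /= m0 <-]].
rewrite lte_pdivlMr ?ltr0n// -EFinM => hm.
have m0' : 0 < m%:R :> R by rewrite ltr0n.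
exists (Num.truncn (g * m%:R / (e / 2))).+1 => n Nn; apply/andP; split; last first.
  by apply: (le_trans (Ehlpp_le n)); rewrite lee_fin -/g ler_wpM2r//; lra.
have gm0 : 0 <= g * m%:R by rewrite mulr_ge0.
have ne : g * m%:R <= n%:R * (e / 2).
  rewrite -ler_pdivrMr//; apply: ltW.
  have /andP[_ h] := truncn_itv (divr_ge0 gm0 (ltW e20)).
  by apply: (lt_le_trans h); rewrite ler_nat.
have [ge|ge] := leP (g - e / 2) 0.
  by apply: (le_trans _ (Ehlpp_ge0 _)); rewrite lee_fin mulr_le0_ge0//; lra.
have dn : n%:R = (n %/ m)%:R * m%:R + (n %% m)%:R :> R by rewrite -natrM -natrD -divn_eq.
have rm : (n %% m)%:R <= m%:R :> R by rewrite ler_nat ltnW// ltn_mod.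
apply: (@le_trans _ _ (Ehlpp ((n %/ m)%:R * m%:R))); last first.
  by apply: Ehlpp_nd; rewrite ?mulr_ge0// dn lerDl.
apply: (le_trans _ (Ehlpp_mul _ _)) => //.
apply: (@le_trans _ _ ((n %/ m)%:R%:E * ((g - e / 2) * m%:R)%:E)%E); last first.
  by rewrite lee_wpmul2l ?lee_fin// ltW.
rewrite -EFinM lee_fin; move: dn rm; set a := (n %/ m)%:R; set b := (n %% m)%:R => dn rm.
rewrite mulrCA; have -> : a * m%:R = n%:R - b by rewrite dn; lra.
have b0 : 0 <= b by [].
nra.
Qed.

End Stationarity.

(** * The almost sure lower bound *)

Section PairwiseLLN.
Context d (T : measurableType d) (R : realType) (P : probability T R).
Variables (A : nat -> set T) (p : R).
Hypothesis mA : forall i, measurable (A i).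
Hypothesis PA : forall i, P (A i) = p%:E.
Hypothesis PAA : forall i j, i != j -> P (A i `&` A j) = (p * p)%:E.

Definition hitcount m (w : T) : R := \sum_(i < m) \1_(A i) w.

Lemma measurable_hitcount m : measurable_fun setT (hitcount m).
Proof. by apply: measurable_sum => i; exact: measurable_indic. Qed.

Lemma hitcount_ge0 m w : 0 <= hitcount m w.
Proof. by apply: sumr_ge0. Qed.

Lemma hitcount_le m n w : (m <= n)%N -> hitcount m w <= hitcount n w.
Proof.
move=> mn; rewrite /hitcount -(subnKC mn) big_split_ord /= lerDl.
by apply: sumr_ge0.
Qed.

Lemma hitprob_ge0 : 0 <= p.
Proof. by rewrite -lee_fin -(PA 0) measure_ge0. Qed.

Lemma hitprob_le1 : p <= 1.
Proof. by rewrite -lee_fin -(PA 0) probability_le1. Qed.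

Lemma integral_hitcount m : (\int[P]_w (hitcount m w)%:E = (p * m%:R)%:E)%E.
Proof.
under eq_integral do rewrite /hitcount -sumEFin.
rewrite (@ge0_integral_sum _ _ _ _ _ measurableT)//; last by move=> i; apply/measurable_EFinP; exact: measurable_indic.
rewrite (eq_bigr (fun=> p%:E)); last by move=> i _; rewrite integral_indic// setIT; exact: PA.
by rewrite sumEFin sumr_const card_ord mulr_natr.
Qed.

Lemma integral_hitcount_sqr m :
  (\int[P]_w (hitcount m w ^+ 2)%:E = (p * m%:R + p * p * (m%:R * m%:R - m%:R))%:E)%E.
Proof.
have -> : (fun w => (hitcount m w ^+ 2)%:E) =
    (fun w => \sum_(i < m) \sum_(j < m) (\1_(A i `&` A j) w)%:E)%E.
  apply/funext => w; rewrite expr2 /hitcount mulr_suml -sumEFin; apply: eq_bigr => i _.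
  rewrite mulr_sumr -sumEFin; apply: eq_bigr => j _.
  by rewrite indicI.
have mI i j : measurable_fun setT (fun w => (\1_(A i `&` A j) w : R)%:E).
  by apply/measurable_EFinP/measurable_indic; exact: measurableI.
rewrite (@ge0_integral_sum _ _ _ _ _ measurableT)//; last first.
- by move=> i w _; apply: sume_ge0 => j _; rewrite lee_fin.
- by move=> i; apply: emeasurable_sum => j.
rewrite (eq_bigr (fun i => \sum_(j < m) (p * p + (i == j)%:R * (p - p * p))%R%:E)%E); last first.
  move=> i _; rewrite (@ge0_integral_sum _ _ _ _ _ measurableT)//; apply: eq_bigr => j _.
  have [<-|ij] := eqVneq i j.
    by rewrite setIid integral_indic// setIT mul1r addrC subrK; exact: PA.
  rewrite integral_indic//; last exact: measurableI.
  by rewrite setIT mul0r addr0; exact: PAA.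
rewrite (eq_bigr (fun i => (p * p * m%:R + (p - p * p))%R%:E)); last first.
  move=> i _; rewrite sumEFin big_split /= sumr_const card_ord mulr_natr.
  rewrite -mulr_suml -natr_sum (bigD1 i)//= eqxx big1 ?addn0 ?mul1r//.
  by move=> j /negbTE; rewrite eq_sym => ->.
by rewrite sumEFin sumr_const card_ord -mulr_natr; congr (_%:E); ring.
Qed.

Lemma chebyshev_hitcount m (e : R) : 0 < e -> (0 < m)%N ->
  (P [set w | (hitcount m w < (p - e) * m%:R)%R] <= ((e ^+ 2 * m%:R)^-1)%:E)%E.
Proof.
move=> e0 m0; have m0' : 0 < m%:R :> R by rewrite ltr0n.
set B := [set w | _].
have mB : measurable B.
  have -> : B = setT `&` (hitcount m @^-1` `]-oo, (p - e) * m%:R[).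
    by rewrite setTI; apply/seteqP; split => w; rewrite /B /= in_itv.
  exact: (measurable_hitcount m).
pose V w := (hitcount m w - p * m%:R) ^+ 2.
have mN := measurable_hitcount m.
have mV : measurable_fun setT (fun w => (V w)%:E).
  by apply/measurable_EFinP; apply: measurable_funX; exact: measurable_funB.
have V0 w : (0 <= (V w)%:E)%E by rewrite lee_fin sqr_ge0.
have Ic (r : R) : (\int[P]_w r%:E = r%:E)%E.
  rewrite integral_cst//; transitivity (r%:E * 1)%E; last by rewrite mule1.
  by congr (_ * _)%E; exact: probability_setT.
have eV : (\int[P]_w (V w)%:E <= m%:R%:E)%E.
  have c0 : 0 <= 2 * p * m%:R by rewrite !mulr_ge0// hitprob_ge0.
  have I0 : (0 <= \int[P]_w (V w)%:E)%E by apply: integral_ge0.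
  (* The square is expanded with the cross term moved to the left, so that every integrand is
     nonnegative. *)
  have E : (\int[P]_w (V w)%:E + \int[P]_w ((2 * p * m%:R)%R%:E * (hitcount m w)%:E) =
      \int[P]_w (hitcount m w ^+ 2)%:E + \int[P]_w ((p * m%:R) ^+ 2)%:E)%E.
    rewrite -!ge0_integralD//=.
    - apply: eq_integral => w _; rewrite -EFinM -!EFinD; congr (_%:E); rewrite /V; ring.
    - by move=> w _; rewrite lee_fin sqr_ge0.
    - by apply/measurable_EFinP; exact: measurable_funX.
    - by move=> w _; rewrite lee_fin sqr_ge0.
    - by move=> w _; rewrite -EFinM lee_fin mulr_ge0// hitcount_ge0.
    - by under eq_fun do rewrite -EFinM; apply/measurable_EFinP; exact: measurable_funM.
  rewrite integral_hitcount_sqr ge0_integralZl_EFin// in E; last first.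
  - by apply/measurable_EFinP.
  - by move=> w _; rewrite lee_fin hitcount_ge0.
  rewrite integral_hitcount Ic in E.
  move: E I0; set I := (\int[P]_w _)%E; case: I => // v [E] _.
  rewrite lee_fin; have p0 := hitprob_ge0; have p1 := hitprob_le1.
  have -> : v = m%:R * (p - p * p) by nra.
  rewrite ler_piMr//; nra.
have H : ((e ^+ 2 * m%:R ^+ 2)%R%:E * P B <= m%:R%:E)%E.
  apply: le_trans eV; rewrite -[B]setIT -integral_indic//.
  rewrite -ge0_integralZl_EFin//; last 2 first.
  - by apply/measurable_EFinP; exact: measurable_indic.
  - by apply: mulr_ge0; exact: sqr_ge0.
  apply: ge0_le_integral => //.
  - by move=> w _; rewrite -EFinM lee_fin; apply: mulr_ge0 => //; apply: mulr_ge0; exact: sqr_ge0.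
  - by under eq_fun do rewrite -EFinM; apply/measurable_EFinP; apply: measurable_funM => //; exact: measurable_indic.
  - move=> w _; rewrite -EFinM lee_fin indicE; have [wB|wB] := boolP (w \in B); last first.
      by rewrite mulr0 sqr_ge0.
    rewrite mulr1 /V -exprMn; move: wB; rewrite inE /B /= => wB.
    have : 0 <= e * m%:R by rewrite mulr_ge0// ltW.
    by rewrite !expr2; nra.
have fB : P B \is a fin_num by exact: fin_num_measure.
move: H; rewrite -(fineK fB) -EFinM !lee_fin => H.
rewrite -[leRHS]div1r ler_pdivlMr ?mulr_gt0 ?exprn_gt0//.
rewrite -(ler_pM2r m0') mul1r; apply: le_trans H; rewrite le_eqVlt; apply/orP; left.
by apply/eqP; ring.
Qed.

(** Telescoping, as [1 / x ^ 2 <= 2 / (x * (x + 1))] for [x >= 1]. *)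
Lemma sum_inv_sqr_le n : \sum_(0 <= k < n) (k.+1%:R ^+ 2)^-1 <= 2 :> R.
Proof.
suff : \sum_(0 <= k < n) (k.+1%:R ^+ 2)^-1 <= 2 - 2 / n.+1%:R :> R.
  by move/le_trans; apply; rewrite gerBl divr_ge0.
elim: n => [|n IH]; first by rewrite big_geq// divr1 subrr.
rewrite big_nat_recr//=; have n1 : 0 < n.+1%:R :> R by [].
have -> : n.+2%:R = n.+1%:R + 1 :> R by rewrite natr1.
apply: (le_trans (lerD IH (lexx _))); have n11 : 1 <= n.+1%:R :> R by rewrite ler1n.
move: (n.+1%:R) n1 n11 => x x0 x1.
have -> : 2 - 2 / (x + 1) = 2 - 2 / x + 2 / (x * (x + 1)) by field; rewrite !gt_eqF//; lra.
rewrite lerD2l ler_pdivlMr; last by rewrite mulr_gt0//; lra.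
rewrite ler_pdivrMl ?exprn_gt0// expr2; nra.
Qed.

(** Along the squares the Chebyshev bounds are summable and Borel-Cantelli applies; between squares
    the count is monotone, and the ratio of consecutive squares tends to 1. *)
Lemma ae_hitcount e : 0 < e ->
  {ae P, forall w, exists M : nat, forall m, (M <= m)%N -> (p - e) * m%:R <= hitcount m w}.
Proof.
move=> e0; pose e2 := e / 2; have e20 : 0 < e2 by rewrite divr_gt0.
pose B k := [set w | hitcount (k.+1 ^ 2) w < (p - e2) * (k.+1 ^ 2)%:R].
have mB k : measurable (B k).
  have -> : B k = setT `&` (hitcount (k.+1 ^ 2) @^-1` `]-oo, (p - e2) * (k.+1 ^ 2)%:R[).
    by rewrite setTI; apply/seteqP; split => w; rewrite /B /= in_itv.
  exact: (measurable_hitcount _).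
have B0 : P (lim_sup_set B) = 0.
  apply: lim_sup_set_cvg0 => //.
  apply: (@le_lt_trans _ _ ((e2 ^+ 2)^-1 * 2)%:E); last exact: ltry.
  apply: lime_le; first by apply: is_cvg_nneseries.
  apply: nearW => n.
  apply: (@le_trans _ _ (\sum_(0 <= k < n) ((e2 ^+ 2)^-1 * (k.+1%:R ^+ 2)^-1)%:E)%E).
    apply: lee_sum => k _; apply: (le_trans (chebyshev_hitcount e20 _)); first by rewrite expn_gt0.
    by rewrite lee_fin invfM natrX.
  by rewrite sumEFin lee_fin -mulr_sumr ler_wpM2l ?invr_ge0 ?sqr_ge0// sum_inv_sqr_le.
exists (lim_sup_set B); split => //.
  by apply: bigcapT_measurable => n; apply: bigcup_measurable.
move=> w /= nw; apply: contrapT => nB; apply: nw.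
have [K HK] : exists K, forall k, (K <= k)%N -> ~ B k w.
  apply: contrapT => nK; apply: nB => n _; apply: contrapT => nn; apply: nK; exists n => k nk Bk.
  by apply: nn; exists k.
have p0 := hitprob_ge0; have p1 := hitprob_le1.
(* From [3 / e2] on, the distance of consecutive squares, at most [3 * k.+1], is at most
   [e2 * k.+1 ^ 2]. *)
pose K' := maxn K (Num.Def.archi_bound (3 / e2)).
exists (K'.+1 ^ 2)%N => m mK.
have [k [Kk km1 km2]] : exists k, [/\ (K' <= k)%N, (k.+1 ^ 2 <= m)%N & (m < k.+2 ^ 2)%N].
  have ex : exists k, (fun k => (k.+1 ^ 2 <= m)%N) k by exists K'.
  have bd k : (fun k => (k.+1 ^ 2 <= m)%N) k -> (k <= m)%N.
    by move=> h; apply: leq_trans h; rewrite -mulnn; nia.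
  case: (ex_maxnP ex bd) => k h1 h2; exists k; split => //; first exact: h2.
  by rewrite ltnNge; apply/negP => /h2; rewrite ltnn.
have h := hitcount_le w km1.
have [pe|pe] := leP p e2; first by apply: (le_trans _ (hitcount_ge0 _ _)); rewrite mulr_le0_ge0//; rewrite /e2 in pe; lra.
have hk : (p - e2) * (k.+1 ^ 2)%:R <= hitcount (k.+1 ^ 2) w.
  by rewrite leNgt; apply/negP; apply: HK; apply: leq_trans Kk; exact: leq_maxl.
apply: le_trans h; apply: le_trans hk; rewrite natrX.
have k3 : 3 <= k.+1%:R * e2.
  rewrite -ler_pdivrMr//; apply: ltW.
  apply: (lt_le_trans (archi_boundP _)); first by rewrite divr_ge0// ltW.
  by rewrite ler_nat ltnW// ltnS; apply: leq_trans Kk; exact: leq_maxr.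
have m1 : k.+1%:R ^+ 2 <= m%:R :> R by rewrite -natrX ler_nat.
have m2 : m%:R <= (k.+1%:R + 1) ^+ 2 :> R by rewrite natr1 -natrX ler_nat ltnW.
have k1 : 1 <= k.+1%:R :> R by rewrite ler1n.
have ee : e = e2 + e2 by rewrite /e2; lra.
rewrite ee; move: (k.+1%:R) (m%:R : R) k3 m1 m2 k1 => x y; rewrite !expr2 => k3 m1 m2 k1.
have h1 : (p - e2) * y <= (p - e2) * (x * x) + 3 * x by nra.
have h2 : 3 * x <= e2 * y by nra.
lra.
Qed.

End PairwiseLLN.

Section LowerBound.
Variables (R : realType) (F : R -> R) (Q : probability (conf R) R).
Hypothesis Fnd : {homo F : x y / x <= y}.
Hypothesis F01 : forall x, 0 <= F x <= 1.
Hypothesis Qvoid : forall s : seq (box R), boxes_ok s -> pairwise (@disjb R) s ->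
  Q (void s) = (expR (- \sum_(B <- s) box_mean F B))%:E.
Hypothesis Fsum : (\sum_(0 <= j <oo) (Num.sqrt (1 - F j%:R))%:E < +oo)%E.

(** Counterpart of [le_threshold_series]: counting from threshold 1 stays below [y], counting from 0
    reaches it, so integer rounding loses at most 1. *)
Lemma thresholds_le (y : \bar R) J : (0 <= y)%E ->
  ((\sum_(j < J) (j.+1%:R%:E < y)%E%:R : R)%:E <= y)%E.
Proof.
case: y => [y| |] //; last by move=> _; exact: leey.
rewrite !lee_fin => y0.
elim: J => [|J IH]; first by rewrite big_ord0.
rewrite big_ord_recr /= lte_fin; have [Jy|Jy] := ltP J.+1%:R y; last by rewrite addr0.
apply: (le_trans _ (ltW Jy)); rewrite -[leRHS]natr1 lerD2r.
apply: (@le_trans _ _ (\sum_(j < J) 1)); last by rewrite sumr_const card_ord.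
by apply: ler_sum => j _; rewrite -[leRHS]/(1%:R) ler_nat leq_b1.
Qed.

Lemma le_threshold_series (y : \bar R) : (0 <= y)%E ->
  (y <= \sum_(0 <= j <oo) ((j%:R%:E < y)%E%:R : R)%:E)%E.
Proof.
have ps J : (\sum_(0 <= j < J) ((j%:R%:E < y)%E%:R : R)%:E <=
    \sum_(0 <= j <oo) ((j%:R%:E < y)%E%:R : R)%:E)%E.
  by apply: (@nneseries_lim_ge R (fun j => ((j%:R%:E < y)%E%:R : R)%:E) xpredT) => j _ _; rewrite lee_fin.
case: y ps => [y| |] ps // y0.
  have y0' : 0 <= y by rewrite -lee_fin.
  apply: (le_trans _ (ps (Num.Def.archi_bound y))).
  rewrite sumEFin lee_fin big_mkord; under eq_bigr do rewrite lte_fin.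
  by apply: le_sum_thresholds; apply: ltW; exact: archi_boundP.
rewrite leye_eq; apply/eqP/eq_infty => r.
apply: (le_trans _ (ps (Num.Def.archi_bound `|r|))).
rewrite sumEFin lee_fin big_mkord; under eq_bigr do rewrite ltry.
rewrite sumr_const card_ord; apply: (le_trans (ler_norm _)); apply: ltW; exact: archi_boundP.
Qed.

Definition block (x a : R) (i : nat) : set (conf R) :=
  [set S | (a%:E < hlpp S (diag (i%:R * x)%R) (diag (i.+1%:R * x)%R))%E].

Lemma measurable_hlpp_gt (x y a : R) : x <= y ->
  measurable [set S : conf R | (a%:E < hlpp S (diag x) (diag y))%E].
Proof.
move=> xy; rewrite -[X in measurable X]setTI; apply: emeasurable_fun_o_infty => //.
exact: measurable_hlpp_diag.
Qed.

Lemma measurable_block x a i : 0 <= x -> measurable (block x a i).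
Proof. by move=> x0; apply: measurable_hlpp_gt; rewrite ler_wpM2r// ler_nat. Qed.

Lemma Q_block x a i : 0 <= x -> Q (block x a i) = Q (block x a 0).
Proof.
move=> x0; rewrite -[RHS](@Q_tconf _ _ _ Qvoid (translate (i%:R * x)))/= ?mulr1//.
  congr (Q _); apply/seteqP; split => S; rewrite /block /= hlpp_translate !mul0r mul1r add0r;
    by have -> : i.+1%:R * x = x + i%:R * x by rewrite -natr1 mulrDl mul1r addrC.
exact: measurable_block.
Qed.

Lemma Q_blockI x a i j : 0 <= x -> i != j ->
  Q (block x a i `&` block x a j) = (Q (block x a 0) * Q (block x a 0))%E.
Proof.
move=> x0 ij.
have res k : block x a k = resconf (diag (k%:R * x)) (diag (k.+1%:R * x)) @^-1` block x a k.
  by apply/seteqP; split => S; rewrite /block /= hlpp_resconf.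
rewrite -{1}(Q_block a i x0) -(Q_block a j x0) (res i) (res j).
apply: (Q_indep Qvoid); try exact: measurable_block.
apply/seteqP; split => // z [[/andP[/= h1 h2] _] [/andP[/= h3 h4] _]].
have [ij'|ij'|e] := ltngtP i j; last by rewrite e eqxx in ij.
  have : i.+1%:R * x <= j%:R * x by rewrite ler_wpM2r// ler_nat.
  lra.
have : j.+1%:R * x <= i%:R * x by rewrite ler_wpM2r// ler_nat.
lra.
Qed.

Lemma hlpp_blocks (x : R) S m : 0 <= x ->
  (\sum_(i < m) hlpp S (diag (i%:R * x)%R) (diag (i.+1%:R * x)%R) <=
   hlpp S (diag 0%R) (diag (m%:R * x)%R))%E.
Proof.
move=> x0; elim: m => [|m IH]; first by rewrite big_ord0 hlpp_ge0.
have m0 : 0 <= m%:R * x by rewrite mulr_ge0.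
have m1 : m%:R * x <= m.+1%:R * x by rewrite ler_wpM2r// ler_nat.
rewrite big_ord_recr /=; apply: (le_trans (leeD2r _ IH)).
exact: (@hlpp_superadd _ S (diag 0) (diag (m%:R * x)) (diag (m.+1%:R * x))).
Qed.

Lemma ae_lower (c : R) : c < fine (gam Q) ->
  {ae Q, forall S, exists N : nat, forall n, (N <= n)%N ->
    ((c * n%:R)%:E <= hlpp S (diag 0%R) (diag n%:R%R))%E}.
Proof.
move=> cg; set g := fine (gam Q) in cg *.
(* The five parts: one for the mean of a block, two for replacing its passage time by finitely many
   integer thresholds, one for the law of large numbers, one for the incomplete last block. *)
pose e := (g - c) / 5; have e0 : 0 < e by rewrite divr_gt0// subr_gt0.
have [N HN] := lin_growth_Ehlpp Fnd F01 Qvoid Fsum e0.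
(* Blocks so long that the rounding loss 1 is at most [n * e]. *)
pose n := maxn N (Num.Def.archi_bound (e^-1)).+1.
have n1 : 1 <= n%:R * e.
  rewrite -ler_pdivrMr// div1r; apply: ltW; apply: (lt_le_trans (archi_boundP _)).
    by rewrite invr_ge0 ltW.
  by rewrite ler_nat; apply: (leq_trans (leqnSn _)); exact: leq_maxr.
have n0 : 0 < n%:R :> R by rewrite ltr0n; exact: (leq_trans (ltn0Sn _) (leq_maxr _ _)).
have /andP[En _] := HN n (leq_maxl _ _); rewrite -/g in En.
pose p j := fine (Q (block n%:R j.+1%:R 0)).
have fb a i : Q (block n%:R a i) \is a fin_num.
  by apply: fin_num_measure; apply: measurable_block; exact: ltW.
(* Finitely many thresholds carry most of the mean: otherwise the threshold series would bound
   [Ehlpp Q n] by [1 + (g - 3 * e) * n], the 1 coming from the threshold 0. *)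
have [J HJ] : exists J, (g - 3 * e) * n%:R < \sum_(j < J) p j.
  apply: contrapT => nJ.
  have HJ J : \sum_(j < J) p j <= (g - 3 * e) * n%:R.
    by rewrite leNgt; apply/negP => h; apply: nJ; exists J.
  suff : (Ehlpp Q n%:R <= (1 + (g - 3 * e) * n%:R)%:E)%E.
    by move=> /(le_trans En); rewrite lee_fin; nra.
  pose f j (S : conf R) := ((j%:R%:E < hlpp S (diag 0%R) (diag n%:R%R))%E%:R : R)%:E.
  have fE j : f j = fun S => (\1_(block n%:R j%:R 0) S)%:E.
    apply/funext => S; rewrite /f indicE /block mul0r mul1r; congr ((nat_of_bool _)%:R%:E).
    by apply/idP/idP => [h|]; [rewrite in_setE|rewrite in_setE].
  have mf j : measurable_fun setT (f j).
    by rewrite fE; apply/measurable_EFinP; apply: measurable_indic; apply: measurable_block; exact: ltW.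
  have f0 j S : (0 <= f j S)%E by rewrite lee_fin.
  apply: (@le_trans _ _ (\int[Q]_S \sum_(0 <= j <oo) f j S)%E).
    apply: ge0_le_integral => //.
    - by move=> S _; exact: hlpp_ge0.
    - by apply: measurable_hlpp_diag; exact: ltW.
    - by apply: ge0_emeasurable_sum.
    - by move=> S _; apply: le_threshold_series; exact: hlpp_ge0.
  rewrite integral_nneseries//.
  apply: lime_le; first by apply: is_cvg_nneseries => k _ _; apply: integral_ge0.
  apply: nearW => -[|K]; first by rewrite big_geq// lee_fin addr_ge0// (le_trans _ (HJ 0%N))// big_ord0.
  have intf j : (\int[Q]_S f j S)%E = (fine (Q (block n%:R j%:R 0)))%:E.
    rewrite fE integral_indic// ?setIT ?fineK//; apply: measurable_block; exact: ltW.
  under eq_bigr do rewrite intf.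
  rewrite sumEFin lee_fin big_mkord big_ord_recl; apply: lerD; last exact: HJ.
  by rewrite -lee_fin fineK// probability_le1//; apply: measurable_block; exact: ltW.
(* The [J] thresholds together then lose at most [e] per block. *)
pose dl := e / J.+1%:R; have dl0 : 0 < dl by rewrite divr_gt0.
have aeJ (j : nat) : {ae Q, forall S, exists M : nat, forall m, (M <= m)%N ->
    (p j - dl) * m%:R <= hitcount R (block n%:R j.+1%:R) m S}.
  apply: ae_hitcount => //.
  - by move=> i; apply: measurable_block; exact: ltW.
  - by move=> i; rewrite /p fineK// Q_block// ltW.
  - by move=> i i' ii'; rewrite EFinM /p !fineK// Q_blockI// ltW.
have /ae_foralln ae1 : forall j : nat, {ae Q, forall S, exists M : nat, forall m, (M <= m)%N ->
    (p j - dl) * m%:R <= hitcount R (block n%:R j.+1%:R) m S} by exact: aeJ.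
apply: filterS ae1 => S HS.
have ex J0 : exists M : nat, forall j m, (j < J0)%N -> (M <= m)%N ->
    (p j - dl) * m%:R <= hitcount R (block n%:R j.+1%:R) m S.
  elim: J0 => [|J' [M HM]]; first by exists 0%N.
  have [M' HM'] := HS J'; exists (maxn M M') => j m; rewrite ltnS leq_eqVlt => /orP[/eqP ->|jJ] Mm.
    by apply: HM'; apply: leq_trans Mm; exact: leq_maxr.
  by apply: HM => //; apply: leq_trans Mm; exact: leq_maxl.
have [M HM] := ex J.
have low m : (M <= m)%N -> (((g - 4 * e) * n%:R * m%:R)%:E <= hlpp S (diag 0%R) (diag (m%:R * n%:R)%R))%E.
  move=> Mm; apply: (le_trans _ (hlpp_blocks S m (ltW n0))).
  apply: (@le_trans _ _ (\sum_(i < m) (\sum_(j < J) \1_(block n%:R j.+1%:R i) S)%:E)%E); last first.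
    apply: lee_sum => i _; apply: le_trans (thresholds_le J (hlpp_ge0 _ _ _)).
    rewrite lee_fin; apply: ler_sum => j _; rewrite indicE /block.
    by case: (boolP (S \in _)) => [|_]; [rewrite in_setE /= => ->|exact: ler0n].
  rewrite sumEFin lee_fin exchange_big /=.
  apply: (@le_trans _ _ (\sum_(j < J) (p j - dl) * m%:R)); last first.
    by apply: ler_sum => j _; exact: HM.
  rewrite -mulr_suml ler_wpM2r// sumrB sumr_const card_ord -[dl *+ J]mulr_natr.
  have : dl * J%:R <= e.
    by rewrite /dl mulrAC ler_pdivrMr// ler_pM2l// ler_nat.
  have : e <= e * n%:R by apply: ler_peMr; [exact: ltW|rewrite ler1n -(ltr0n R)].
  move: HJ; move: (\sum_(j < J) p j) (dl * _) (n%:R) => x y z; nra.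
have ce : c = g - 5 * e by rewrite /e; lra.
have [c0|c0] := leP (c + e) 0.
  exists 0%N => k _; apply: (le_trans _ (hlpp_ge0 _ _ _)).
  by rewrite lee_fin mulr_le0_ge0//; lra.
pose K := Num.Def.archi_bound ((c + e) * n%:R / e).
have Kb : (c + e) * n%:R <= K%:R * e.
  rewrite -ler_pdivrMr//; apply: ltW; apply: archi_boundP.
  by rewrite divr_ge0 ?(ltW e0)// mulr_ge0// ltW.
have n0' : (0 < n)%N by rewrite -(ltr0n R).
exists (maxn K (M * n)) => k Kk.
have k1 : K%:R <= k%:R :> R by rewrite ler_nat; apply: leq_trans Kk; exact: leq_maxl.
have Mk : (M <= k %/ n)%N by rewrite leq_divRL//; apply: leq_trans Kk; exact: leq_maxr.
have dn : k%:R = (k %/ n)%:R * n%:R + (k %% n)%:R :> R by rewrite -natrM -natrD -divn_eq.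
have rm : (k %% n)%:R <= n%:R :> R by rewrite ler_nat ltnW// ltn_mod.
apply: (@le_trans _ _ (hlpp S (diag 0%R) (diag ((k %/ n)%:R * n%:R)%R))); last first.
  by apply: hlpp_mono => //=; rewrite dn lerDl.
apply: (le_trans _ (low _ Mk)); rewrite lee_fin.
have -> : g - 4 * e = c + e by rewrite ce; lra.
rewrite -mulrA [n%:R * _]mulrC; have -> : (k %/ n)%:R * n%:R = k%:R - (k %% n)%:R :> R by rewrite dn; lra.
have b0 : 0 <= (k %% n)%:R :> R by [].
nra.
Qed.

End LowerBound.

(** * The almost sure upper bound *)

Section Greedy.
Variable R : realType.

Lemma limn_esup_lt (u : (\bar R)^nat) (c : \bar R) : (limn_esup u < c)%E ->
  exists N, forall n, (N <= n)%N -> (u n < c)%E.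
Proof.
rewrite /limn_esup /limf_esup => /ereal_inf_lt[_ [V [N _ NV] <-] Vc].
exists N => n Nn; apply: le_lt_trans Vc; apply: ereal_sup_ubound.
by exists n => //; exact: NV.
Qed.

Lemma limn_esup_le (u : (\bar R)^nat) (c : \bar R) N :
  (forall n, (N <= n)%N -> (u n <= c)%E) -> (limn_esup u <= c)%E.
Proof.
move=> H; rewrite /limn_esup /limf_esup.
apply: (@le_trans _ _ (ereal_sup (u @` [set n | (N <= n)%N]))).
  by apply: ereal_inf_lbound; exists [set n | (N <= n)%N] => //; exists N.
by apply: ge_ereal_sup => _ [n /= Nn <-]; exact: H.
Qed.

(* Starting from [i], jump over the whole block [i, i + n) when [E i] provides one, whose
   yield [n * v i] pays for all the [v j] in it because [v] is nonincreasing;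
   otherwise advance by one. *)
Lemma greedy_cover (h : nat -> nat -> \bar R) (v : nat -> R) (E : nat -> bool) M :
  (forall i j, 0 <= h i j)%E ->
  (forall i j k, (i <= j)%N -> (j <= k)%N -> (h i j + h j k <= h i k)%E) ->
  (forall i, 0 <= v i) -> (forall i j, (i <= j)%N -> v j <= v i) ->
  (forall i, E i -> exists n, [/\ (0 < n)%N, (n <= M)%N & ((n%:R * v i)%:E <= h i (i + n)%N)%E]) ->
  forall N i, ((\sum_(k < N - M) v (i + k)%N * (E (i + k)%N)%:R)%:E <= h i (i + N)%N)%E.
Proof.
move=> h0 hs v0 vd HE N; have [m] := ubnP N; elim: m N => // m IH N /ltnSE Nm i.
(* Only the first [N - M] indices are claimed, because a block started later might run past the
   end. *)
have [NM|MN] := leqP N M.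
  by have := NM; rewrite -subn_eq0 => /eqP ->; rewrite big_ord0.
case Ei: (E i).
  have [n [n0 nM hn]] := HE i Ei.
  have nN : (n <= N)%N by apply: (leq_trans nM); exact: ltnW.
  have IH' := IH (N - n)%N (leq_trans (_ : _ < N)%N Nm) (i + n)%N.
  rewrite -addnA subnKC// in IH'.
  apply: (le_trans _ (hs i (i + n)%N (i + N)%N (leq_addr _ _) _)); last by rewrite leq_add2l.
  apply: le_trans (leeD hn (IH' _)); last by rewrite ltn_subrL n0; exact: leq_trans n0 nN.
  rewrite -EFinD lee_fin.
  have first_le q : (q <= n)%N -> \sum_(k < q) v (i + k)%N * (E (i + k)%N)%:R <= n%:R * v i.
    move=> qn; apply: (@le_trans _ _ (\sum_(k < q) v i)).
      apply: ler_sum => k _; apply: (@le_trans _ _ (v (i + k)%N)).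
        by case: (E _); rewrite ?mulr1 ?mulr0.
      by apply: vd; exact: leq_addr.
    by rewrite sumr_const card_ord -[leLHS]mulr_natl ler_wpM2r// ler_nat.
  have [q|q] := leqP (N - M) n.
    apply: (le_trans (first_le _ q)); rewrite lerDl; apply: sumr_ge0 => k _.
    by rewrite mulr_ge0.
  rewrite -(subnKC (ltnW q)) big_split_ord /=; apply: lerD; first exact: first_le.
  rewrite (_ : N - n - M = N - M - n)%N; last by rewrite -!subnDA addnC.
  by apply: ler_sum => k _; rewrite addnA.
have N0 : (0 < N)%N by apply: leq_trans MN.
have iN : (i.+1 + N.-1 = i + N)%N by lia.
have IH' := IH N.-1 _ i.+1; rewrite iN in IH'.
apply: (@le_trans _ _ (h i.+1 (i + N)%N)); last first.
  apply: le_trans (hs i i.+1 (i + N)%N (leqnSn _) _); last by rewrite -addn1 leq_add2l.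
  by rewrite leeDr.
apply: le_trans (IH' _); last by rewrite prednK.
have -> : (N - M = (N.-1 - M).+1)%N by lia.
rewrite big_ord_recl addn0 Ei mulr0 add0r lee_fin.
apply: ler_sum => k _.
by have -> : (i + lift ord0 k = i.+1 + k)%N by rewrite lift0 addnS addSn.
Qed.

End Greedy.

Section UpperBound.
Variables (R : realType) (F : R -> R) (Q : probability (conf R) R).
Hypothesis Fnd : {homo F : x y / x <= y}.
Hypothesis F01 : forall x, 0 <= F x <= 1.
Hypothesis Qvoid : forall s : seq (box R), boxes_ok s -> pairwise (@disjb R) s ->
  Q (void s) = (expR (- \sum_(B <- s) box_mean F B))%:E.
Hypothesis Fsum : (\sum_(0 <= j <oo) (Num.sqrt (1 - F j%:R))%:E < +oo)%E.

Let g := fine (gam Q).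

Lemma fine_gam_ge0 : 0 <= g.
Proof. by rewrite fine_ge0// gam_ge0. Qed.

Definition hh (S : conf R) (i j : nat) : \bar R := hlpp S (diag i%:R) (diag j%:R).

Definition rate (S : conf R) (n : nat) : \bar R := (hh S 0 n * (n%:R^-1)%:E)%E.

Definition shift (i : nat) (S : conf R) : conf R := tconf (translate i%:R) S.

Lemma hh_shift i S m n : hh (shift i S) m n = hh S (m + i) (n + i).
Proof. by rewrite /hh /shift hlpp_translate !natrD. Qed.

Lemma shift_add i j S : shift i (shift j S) = shift (i + j) S.
Proof.
rewrite /shift /tconf /aff /=; apply/seteqP; split => z /=;
  by rewrite !mul1r -!addrA -!natrD.
Qed.

Lemma hh_ge0 S i j : (0 <= hh S i j)%E. Proof. exact: hlpp_ge0. Qed.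

Lemma hh_superadd S i j k : (i <= j)%N -> (j <= k)%N -> (hh S i j + hh S j k <= hh S i k)%E.
Proof. by move=> ij jk; apply: hlpp_superadd; rewrite /= ler_nat. Qed.

Lemma rate_ge0 S n : (0 <= rate S n)%E.
Proof. by rewrite mule_ge0 ?hh_ge0// lee_fin invr_ge0. Qed.

Definition limrate (S : conf R) : \bar R := limn_esup (rate S).

Lemma limrate_ge0 S : (0 <= limrate S)%E.
Proof.
rewrite leNgt; apply/negP => /limn_esup_lt[N /(_ N (leqnn _))].
by rewrite ltNge rate_ge0.
Qed.

(** The shifted square of side [n] sits inside the original one of side [n + 1], and the ratio of
    the sides tends to 1. *)
Lemma limrate_shift S : (limrate (shift 1 S) <= limrate S)%E.
Proof.
have := limrate_ge0 S; case E: (limrate S) => [r| |] // r0; last exact: leey.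
have r0' : 0 <= r by rewrite -lee_fin.
apply/lee_addgt0Pr => e e0.
have [N HN] : exists N, forall n, (N <= n)%N -> (rate S n < (r + e / 2)%:E)%E.
  by apply: limn_esup_lt; rewrite -/(limrate S) E lte_fin; lra.
pose K := Num.Def.archi_bound ((r + e / 2) / (e / 2)).
apply: (@limn_esup_le _ _ _ (maxn N K).+1) => -[//|n]; rewrite ltnS => Nn.
have n0 : 0 < n.+1%:R :> R by [].
rewrite /rate hh_shift add0n addn1 lee_pdivrMr//.
apply: (@le_trans _ _ (hh S 0 n.+2)); first by apply: hlpp_mono => //=; rewrite ler_nat.
have := HN n.+2; rewrite /rate lte_pdivrMr// => h.
apply: (le_trans (ltW (h _))); first by rewrite (leq_trans (leq_maxl _ _) (leq_trans Nn _))// -addn2 leq_addr.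
rewrite -EFinD -!EFinM lee_fin -[n.+2%:R]natr1.
have Kn : (r + e / 2) <= n.+1%:R * (e / 2).
  rewrite -ler_pdivrMr; last by lra.
  apply: ltW; apply: (lt_le_trans (archi_boundP _)); first by rewrite divr_ge0//; lra.
  by rewrite ler_nat; apply: (leq_trans (leq_maxr N K)); apply: leq_trans Nn _.
by move: (n.+1%:R) Kn => x; nra.
Qed.

(** Bounded by the truncation, hence integrable even where the upper limit is infinite; a level
    above [g] is what later turns [vrate <= g] into [limrate <= g]. *)
Definition vrate (S : conf R) : R := fine (mine (limrate S) (g + 1)%:E).

Lemma vrateE S : (vrate S)%:E = mine (limrate S) (g + 1)%:E.
Proof.
rewrite /vrate fineK//; have g0 := fine_gam_ge0.
have := limrate_ge0 S; case: (limrate S) => [r| |] // _.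
by rewrite -EFin_min.
Qed.

Lemma vrate_ge0 S : 0 <= vrate S.
Proof.
rewrite -lee_fin vrateE le_min limrate_ge0 lee_fin.
by have := fine_gam_ge0; lra.
Qed.

Lemma vrate_le S : vrate S <= g + 1.
Proof. by rewrite -lee_fin vrateE ge_min lexx orbT. Qed.

Lemma vrate_shift1 S : vrate (shift 1 S) <= vrate S.
Proof.
by rewrite -lee_fin !vrateE le_min ge_min limrate_shift /= ge_min lexx orbT.
Qed.

Lemma vrate_shift i j S : (i <= j)%N -> vrate (shift j S) <= vrate (shift i S).
Proof.
move=> /subnK <-; elim: (j - i)%N => [//|k IH].
by rewrite addSn -add1n -shift_add; apply: le_trans (vrate_shift1 _) IH.
Qed.

(** The cap [M] on the block length bounds the stretch lost at the end of the covering; it tends to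
    infinity only after integration. *)
Definition fast (eta : R) (M : nat) : set (conf R) :=
  \bigcup_(n in [set n | (0 < n <= M)%N]) [set S | ((n%:R * (eta * vrate S))%:E <= hh S 0 n)%E].

(** If every block had rate below [eta * vrate S], the upper limit would be at most that, which is
    less than [vrate S <= limrate S] when [vrate S > 0]. *)
Lemma fast_ex eta S : 0 < eta < 1 -> exists M, fast eta M S.
Proof.
move=> /andP[eta0 eta1]; have [v0|v0] := leP (vrate S) 0.
  exists 1%N; exists 1%N => //=; rewrite mul1r.
  apply: (le_trans _ (hh_ge0 _ _ _)); rewrite lee_fin.
  by rewrite mulr_ge0_le0// ltW.
apply: contrapT => H.
suff : (limrate S <= (eta * vrate S)%:E)%E.
  move=> h; have : ((vrate S)%:E <= (eta * vrate S)%:E)%E.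
    by apply: le_trans h; rewrite vrateE ge_min lexx.
  by rewrite lee_fin; nra.
apply: (@limn_esup_le _ _ _ 1) => n n0.
rewrite leNgt; apply/negP => h; apply: H; exists n, n; first by rewrite /= n0 leqnn.
move: h; rewrite /= /rate lte_pdivlMr ?ltr0n// => /ltW; rewrite -EFinM.
by rewrite mulrC.
Qed.

Lemma fast_le eta M M' : (M <= M')%N -> fast eta M `<=` fast eta M'.
Proof. by move=> MM' S [n /= /andP[n0 nM] h]; exists n => //=; rewrite n0 (leq_trans nM). Qed.

Lemma measurable_hh i j : (i <= j)%N -> measurable_fun setT (fun S => hh S i j).
Proof. by move=> ij; apply: measurable_hlpp_diag; rewrite ler_nat. Qed.

Lemma measurable_vrate : measurable_fun setT vrate.
Proof.
apply/measurable_EFinP; rewrite (_ : EFin \o vrate = fun S => mine (limrate S) (g + 1)%:E); last first.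
  by apply/funext => S /=; rewrite vrateE.
apply: measurable_mine => //; apply: measurable_fun_limn_esup => n.
apply: emeasurable_funM => //; exact: measurable_hh.
Qed.

Lemma measurable_fast eta M : measurable (fast eta M).
Proof.
apply: bigcup_measurable => n _.
rewrite -[X in measurable X]setTI; apply: measurable_lee => //.
  apply/measurable_EFinP; apply: measurable_funM => //; apply: measurable_funM => //.
  exact: measurable_vrate.
exact: measurable_hh.
Qed.

Lemma fast_sum_le eta M N S : 0 < eta ->
  ((\sum_(k < N - M) eta * vrate (shift k S) * \1_(fast eta M) (shift k S))%:E <= hh S 0 N)%E.
Proof.
move=> eta0.
have := @greedy_cover R (hh S) (fun i => eta * vrate (shift i S))
  (fun i => shift i S \in fast eta M) M (hh_ge0 S) (@hh_superadd S) _ _ _ N 0.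
rewrite !add0n; apply.
- by move=> i; rewrite mulr_ge0 ?vrate_ge0// ltW.
- by move=> i j ij; rewrite ler_pM2l// vrate_shift.
- move=> i; rewrite in_setE => -[n /= /andP[n0 nM]]; rewrite hh_shift add0n addnC => h.
  by exists n.
Qed.

(** The greedy bound is integrated: by stationarity its [N - M] summands have equal upper estimates
    with one common mean, while [hh S 0 N] has mean at most [g * N]. Large [N] makes [M]
    negligible. *)
Lemma integral_fast_le eta M : 0 < eta < 1 ->
  (\int[Q]_S (eta * vrate S * \1_(fast eta M) S)%:E <= g%:E)%E.
Proof.
move=> /andP[eta0 eta1].
pose f S := (eta * vrate S * \1_(fast eta M) S)%:E.
have f0 S : (0 <= f S)%E by rewrite lee_fin !mulr_ge0 ?vrate_ge0// ltW.
have mf : measurable_fun setT f.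
  apply/measurable_EFinP; apply: measurable_funM; last exact: measurable_indic (measurable_fast _ _).
  by apply: measurable_funM => //; exact: measurable_vrate.
have fle S : (f S <= (g + 1)%:E)%E.
  have i1 : (\1_(fast eta M) S : R) <= 1 by rewrite indicE lern1 leq_b1.
  have ev : eta * vrate S <= g + 1.
    apply: (@le_trans _ _ (1 * vrate S)); last by rewrite mul1r vrate_le.
    by apply: ler_wpM2r; [exact: vrate_ge0|exact: ltW].
  rewrite lee_fin -[leRHS]mulr1; apply: ler_pM => //.
  by rewrite mulr_ge0 ?vrate_ge0// ltW.
have fin : (\int[Q]_S f S)%E \is a fin_num.
  rewrite ge0_fin_numE; last by apply: integral_ge0.
  apply: (@le_lt_trans _ _ (\int[Q]_S (g + 1)%:E)%E).
    apply: ge0_le_integral => //.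
  rewrite integral_cst//; apply: (@le_lt_trans _ _ ((g + 1)%:E * 1)%E); last by rewrite mule1 ltry.
  by rewrite lee_wpmul2l ?lee_fin ?probability_le1//; have := fine_gam_ge0; lra.
have fshift (k : nat) : (\int[Q]_S f (shift k S) = \int[Q]_S f S)%E.
  by apply: (integral_tconf Qvoid) => //=; rewrite mulr1.
have mfs (k : nat) : measurable_fun setT (fun S => f (shift k S)).
  apply: measurableT_comp => //; exact: measurable_tconf.
rewrite -/(f _) -(fineK fin) lee_fin; set I := fine _.
have HN N : (N - M)%:R * I <= g * N%:R.
  rewrite -lee_fin; apply: (le_trans _ (Ehlpp_le Fnd F01 Qvoid Fsum N)).
  rewrite EFinM /I fineK//.
  have -> : ((N - M)%:R%:E * \int[Q]_S f S = \int[Q]_S \sum_(k < N - M) f (shift k S))%E.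
    rewrite (@ge0_integral_sum _ _ _ _ _ measurableT)//.
    rewrite (eq_bigr (fun=> (\int[Q]_S f S)%E)); last by move=> k _; exact: fshift.
    by rewrite -(fineK fin) -EFinM sumEFin sumr_const card_ord mulr_natl.
  apply: ge0_le_integral => //.
  - by move=> S _; apply: sume_ge0.
  - by apply: emeasurable_sum.
  - exact: measurable_hlpp_diag.
  - by move=> S _; rewrite sumEFin; apply: (fast_sum_le M N S eta0).
rewrite leNgt; apply/negP => gI.
(* If [I > g], any [N] above [g * M / (I - g)] contradicts [N * I <= g * (N + M)]. *)
have MI0 : 0 <= g * M%:R / (I - g) by rewrite divr_ge0 ?mulr_ge0 ?fine_gam_ge0// subr_ge0 ltW.
have := archi_boundP MI0; set N := Num.Def.archi_bound _.
rewrite ltr_pdivrMr ?subr_gt0// => h.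
by have := HN (N + M)%N; rewrite addnK natrD; lra.
Qed.

End UpperBound.

Lemma ae_imp d (T : measurableType d) (R : realType) (mu : measure T R) (p q : T -> Prop) :
  (forall x, p x -> q x) -> {ae mu, forall x, p x} -> {ae mu, forall x, q x}.
Proof.
by move=> pq; apply: negligibleS => x /= nq px; apply: nq; exact: pq.
Qed.

Section AlmostSure.
Variables (R : realType) (F : R -> R) (Q : probability (conf R) R).
Hypothesis Fnd : {homo F : x y / x <= y}.
Hypothesis F01 : forall x, 0 <= F x <= 1.
Hypothesis Qvoid : forall s : seq (box R), boxes_ok s -> pairwise (@disjb R) s ->
  Q (void s) = (expR (- \sum_(B <- s) box_mean F B))%:E.
Hypothesis Fsum : (\sum_(0 <= j <oo) (Num.sqrt (1 - F j%:R))%:E < +oo)%E.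

Let g := fine (gam Q).

(** Monotone convergence in [M]: by [fast_ex] the indicators are eventually 1 at each
    configuration. *)
Lemma integral_eta_vrate_le eta : 0 < eta < 1 ->
  (\int[Q]_S (eta * vrate Q S)%:E <= g%:E)%E.
Proof.
move=> eta01; have /andP[eta0 _] := eta01.
pose f M S := (eta * vrate Q S * \1_(fast Q eta M) S)%:E.
have f0 M S : (0 <= f M S)%E by rewrite lee_fin !mulr_ge0 ?vrate_ge0// ltW.
have mf M : measurable_fun setT (f M).
  apply/measurable_EFinP; apply: measurable_funM; last exact: measurable_indic (measurable_fast _ _ _).
  by apply: measurable_funM => //; exact: measurable_vrate.
have nd S : {homo f^~ S : n m / (n <= m)%N >-> (n <= m)%E}.
  move=> n m nm; rewrite lee_fin ler_wpM2l ?mulr_ge0 ?vrate_ge0 ?(ltW eta0)//.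
  rewrite !indicE ler_nat; case: (boolP (S \in fast Q eta n)) => //; rewrite in_setE => h.
  by rewrite mem_set//; exact: fast_le h.
have lim S : limn (f^~ S) = (eta * vrate Q S)%:E.
  apply: lim_near_cst => //; have [M hM] := fast_ex Q S eta01.
  near=> n; rewrite /f indicE mem_set ?mulr1//.
  by apply: fast_le hM; near: n; exact: nbhs_infty_ge.
have -> : (\int[Q]_S (eta * vrate Q S)%:E = \int[Q]_S (fun S' => limn (f^~ S')) S)%E.
  by apply: eq_integral => S _; rewrite lim.
rewrite monotone_convergence//.
apply: lime_le.
  apply: ereal_nondecreasing_is_cvgn => n m nm.
  by apply: ge0_le_integral => // S _; exact: nd.
by apply: nearW => M; apply: (integral_fast_le Fnd F01 Qvoid Fsum).
Unshelve. all: by end_near. Qed.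

Lemma integral_vrate_le : (\int[Q]_S (vrate Q S)%:E <= g%:E)%E.
Proof.
have g0 : 0 <= g := fine_gam_ge0 Q.
have mv : measurable_fun setT (EFin \o vrate Q).
  by apply/measurable_EFinP; exact: measurable_vrate.
have v0 S : (0 <= (vrate Q S)%:E)%E by rewrite lee_fin vrate_ge0.
have H eta : 0 < eta < 1 -> (eta%:E * \int[Q]_S (vrate Q S)%:E <= g%:E)%E.
  move=> eta01; have /andP[eta0 _] := eta01.
  rewrite -ge0_integralZl_EFin// ?(ltW eta0)//.
  exact: integral_eta_vrate_le.
have I0 : (0 <= \int[Q]_S (vrate Q S)%:E)%E by apply: integral_ge0.
move: H I0; set I := (\int[Q]_S _)%E; case: I => [r| |] H // r0; last first.
  have h : 0 < 2^-1 :> R by [].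
  have := H 2^-1; rewrite gt0_muley ?lte_fin// => H'.
  by have := H' (_ : 0 < 2^-1 < 1); rewrite leye_eq; apply; apply/andP; split; lra.
rewrite lee_fin leNgt; apply/negP => gr; have r0' : 0 < r by lra.
(* The [eta] for which [eta * r] is the midpoint of [r] and [g], still above [g]. *)
have h : 0 < (r + g) / (2 * r) < 1.
  by apply/andP; split; [rewrite divr_gt0|rewrite ltr_pdivrMr]; lra.
have := H _ h; rewrite -EFinM lee_fin; have -> : (r + g) / (2 * r) * r = (r + g) / 2.
  by field; rewrite gt_eqF.
lra.
Qed.

Lemma ae_lower_all : {ae Q, forall S, forall e : R, 0 < e -> exists N : nat, forall n, (N <= n)%N ->
    (((g - e) * n%:R)%:E <= hh S 0 n)%E}.
Proof.
have H (k : nat) : {ae Q, forall S, exists N : nat, forall n, (N <= n)%N ->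
    (((g - k.+1%:R^-1) * n%:R)%:E <= hlpp S (diag 0%R) (diag n%:R%R))%E}.
  apply: (ae_lower Fnd F01 Qvoid Fsum).
  by rewrite -/g ltrBlDr ltrDl invr_gt0.
have /ae_foralln : forall k : nat, {ae Q, forall S, exists N : nat, forall n, (N <= n)%N ->
    (((g - k.+1%:R^-1) * n%:R)%:E <= hlpp S (diag 0%R) (diag n%:R%R))%E} by exact: H.
apply: filterS => S HS e e0; have [N HN] := HS (Num.Def.archi_bound (e^-1)).
exists N => n Nn; apply: le_trans (HN n Nn); rewrite lee_fin ler_wpM2r// lerD2l lerN2.
rewrite -[leRHS]invrK lef_pV2 ?posrE ?invr_gt0//.
by apply: ltW; apply: (lt_trans (archi_boundP _)); rewrite ?ltr_nat// invr_ge0 ltW.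
Qed.

Lemma ae_limrate_le : {ae Q, forall S, (limrate S <= g%:E)%E}.
Proof.
have lo : {ae Q, forall S, g <= vrate Q S}.
  apply: filterS ae_lower_all => S HS; rewrite -lee_fin vrateE le_min lee_fin lerDl ler01 andbT.
  apply/lee_subgt0Pr => e e0; have [N HN] := HS e e0.
  rewrite leNgt; apply/negP => /limn_esup_lt[N' HN'].
  have := HN' (maxn N N').+1 (leq_trans (leq_maxr _ _) (leqnSn _)).
  rewrite ltNge /rate lee_pdivlMr ?ltr0n// -EFinB -EFinM => /negP; apply.
  by apply: HN; exact: (leq_trans (leq_maxl _ _) (leqnSn _)).
(* The positive part is nonnegative everywhere and equals [vrate Q S - g] off a null set; its mean
   must vanish. *)
pose psi S := Num.max (vrate Q S - g) 0.
have mv := measurable_vrate Q.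
have mpsi : measurable_fun setT (EFin \o psi).
  apply/measurable_EFinP; apply: measurable_maxr => //; exact: measurable_funB.
have psi0 S : 0 <= psi S by rewrite le_max lexx orbT.
have g0 : 0 <= g := fine_gam_ge0 Q.
have PT : (\int[Q]_S g%:E = g%:E)%E.
  rewrite integral_cst//; transitivity (g%:E * 1)%E; last by rewrite mule1.
  by congr (_ * _)%E; exact: probability_setT.
have E : (\int[Q]_S (psi S)%:E + g%:E <= g%:E)%E.
  apply: le_trans integral_vrate_le; rewrite -{1}PT -ge0_integralD//; last by move=> S _; rewrite lee_fin.
  rewrite le_eqVlt; apply/orP; left; apply/eqP; apply: ge0_ae_eq_integral => //.
  - by apply: emeasurable_funD.
  - by apply/measurable_EFinP.
  - by move=> S _; rewrite -EFinD lee_fin addr_ge0.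
  - by move=> S _; rewrite lee_fin vrate_ge0.
  apply: filterS lo => S gS _; rewrite -EFinD; congr (_%:E).
  by rewrite /psi max_l ?subrK// subr_ge0.
have Z : (\int[Q]_S `|(EFin \o psi) S| = 0)%E.
  rewrite (eq_integral (EFin \o psi)); last by move=> S _; rewrite gee0_abs// lee_fin.
  apply/eqP; rewrite eq_le integral_ge0 ?andbT; last by move=> S _; rewrite lee_fin.
  by move: E; rewrite -leeBrDr// subee.
have [/(_ Z) psi_ae _] := @ae_eq_integral_abs _ _ _ Q setT measurableT (EFin \o psi) mpsi.
apply: filterS psi_ae => S /(_ Logic.I) [psiS].
have : (vrate Q S)%:E = mine (limrate S) (g + 1)%:E by exact: vrateE.
have vS : vrate Q S <= g.
  by rewrite -subr_le0 -psiS /psi le_max lexx.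
move=> E'; have : (mine (limrate S) (g + 1)%:E <= g%:E)%E by rewrite -E' lee_fin.
rewrite ge_min => /orP[//|]; rewrite lee_fin => h; exfalso; lra.
Qed.

Lemma ae_lin_growth :
  {ae Q, forall S, lin_growth (fun r => hlpp S (diag 0) (diag r)) g}.
Proof.
apply: filterS2 ae_lower_all ae_limrate_le => S lo up e e0.
have [N HN] := lo e e0.
have [N' HN'] : exists N, forall n, (N <= n)%N -> (rate S n < (g + e)%:E)%E.
  by apply: limn_esup_lt; apply: le_lt_trans up _; rewrite lte_fin; lra.
exists (maxn N N').+1 => -[//|n]; rewrite ltnS => nN.
apply/andP; split.
  by apply: HN; apply: (leq_trans (leq_maxl _ _)); apply: leq_trans nN _.
have := HN' n.+1; rewrite /rate lte_pdivrMr// -EFinM => h; apply/ltW/h.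
by apply: (leq_trans (leq_maxr N _)); apply: leq_trans nN _.
Qed.

Lemma ae_hlpp_cvg :
  {ae Q, forall S, (hlpp S (diag 0%R) (diag r) * (r^-1)%:E)%E @[r --> +oo] --> g%:E}.
Proof.
move: ae_lin_growth; apply: ae_imp => S HS; apply: cvg_lin_growth HS.
- exact: fine_gam_ge0.
- by move=> r s r0 rs; exact: hlpp_mono.
- exact: hlpp_ge0.
Qed.

Lemma Ehlpp_cvg : (Ehlpp Q r * (r^-1)%:E)%E @[r --> +oo] --> g%:E.
Proof.
apply: cvg_lin_growth.
- exact: fine_gam_ge0.
- by move=> r s r0 rs; exact: Ehlpp_nd.
- exact: Ehlpp_ge0.
- exact: (lin_growth_Ehlpp Fnd F01 Qvoid Fsum).
Qed.

(** * From the diagonal to a general direction *)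

Lemma cvg_scale (h : R -> \bar R) (l s : R) : 0 < s ->
  (h r * (r^-1)%:E)%E @[r --> +oo] --> l%:E ->
  (h (r * s)%R * (r^-1)%:E)%E @[r --> +oo] --> (l * s)%:E.
Proof.
move=> s0 hl.
have cs : r * s @[r --> +oo] --> +oo.
  apply/cvgryPge => A; apply: filterS (nbhs_pinfty_ge (num_real (A / s))) => r.
  by rewrite ler_pdivrMr.
have fs : s%:E \is a fin_num by [].
have H := cvgeZr fs (cvg_comp _ _ cs hl).
rewrite EFinM; apply: cvg_trans H; apply: near_eq_cvg; near=> r => /=.
rewrite -muleA -EFinM; congr (_ * _%:E)%E.
have r0 : 0 < r by near: r; apply: nbhs_pinfty_gt; rewrite num_real.
by rewrite invfM -mulrA mulVf ?mulr1// gt_eqF.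
Unshelve. all: by end_near. Qed.

Lemma ae_tconf (k : (R * R) * (R * R)) (p : conf R -> Prop) :
  0 < k.1.1 -> 0 < k.1.2 -> k.1.1 * k.1.2 = 1 ->
  {ae Q, forall S, p S} -> {ae Q, forall S, p (tconf k S)}.
Proof.
move=> k1 k2 k12 [N [mN N0 pN]]; exists (tconf k @^-1` N); split.
- by apply: measurable_conf_preimage => //; exact: measurable_tconf.
- by rewrite (Q_tconf Qvoid).
- by move=> S nS; apply: pN.
Qed.

(* The area-preserving diagonal map that sends the direction [(1, 1)] to [(x, t)]. *)
Definition hyp_squeeze (x t : R) : (R * R) * (R * R) :=
  ((x / Num.sqrt (x * t), t / Num.sqrt (x * t)), (0, 0)).

Section Direction.
Variables x t : R.
Hypotheses (x0 : 0 < x) (t0 : 0 < t).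

(** Source of the factor [sqrt (x * t)]: time [r] in direction [(x, t)] is time [r * sqrt (x * t)]
    on the diagonal. *)
Lemma hyp_squeeze_diag r :
  aff (hyp_squeeze x t) (diag (r * Num.sqrt (x * t))) = (r * x, r * t).
Proof.
have s0 : Num.sqrt (x * t) != 0 by rewrite gt_eqF// sqrtr_gt0 mulr_gt0.
by rewrite /aff /hyp_squeeze /diag /=; congr (_, _); field.
Qed.

Lemma hyp_squeeze0 : aff (hyp_squeeze x t) (diag 0) = (0, 0).
Proof. by rewrite /aff /hyp_squeeze /diag /= !mulr0 !addr0. Qed.

Lemma hyp_squeeze_gt0 : 0 < (hyp_squeeze x t).1.1 /\ 0 < (hyp_squeeze x t).1.2.
Proof. by rewrite /= !divr_gt0// sqrtr_gt0 mulr_gt0. Qed.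

Lemma hyp_squeeze_area : (hyp_squeeze x t).1.1 * (hyp_squeeze x t).1.2 = 1.
Proof.
have s0 : Num.sqrt (x * t) != 0 by rewrite gt_eqF// sqrtr_gt0 mulr_gt0.
rewrite /= mulf_div -expr2 sqr_sqrtr ?ltW ?mulr_gt0//.
by rewrite divff// mulf_neq0// gt_eqF.
Qed.

(** The limit statement is pulled back as a whole, so a single null set serves all [r]. *)
Lemma ae_hlpp_cvg_dir :
  {ae Q, forall S, (hlpp S (0%R, 0%R) ((r * x)%R, (r * t)%R) * (r^-1)%:E)%E
    @[r --> +oo] --> (g * Num.sqrt (x * t))%:E}.
Proof.
have [k1 k2] := hyp_squeeze_gt0.
have s0 : 0 < Num.sqrt (x * t) by rewrite sqrtr_gt0 mulr_gt0.
have := ae_tconf k1 k2 hyp_squeeze_area ae_hlpp_cvg.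
apply: ae_imp => S /(cvg_scale s0).
suff -> : (fun r => hlpp (tconf (hyp_squeeze x t) S) (diag 0%R) (diag (r * Num.sqrt (x * t))%R) * (r^-1)%:E)%E =
   (fun r => hlpp S (0%R, 0%R) ((r * x)%R, (r * t)%R) * (r^-1)%:E)%E by [].
by apply/funext => r; rewrite hlpp_tconf// hyp_squeeze_diag hyp_squeeze0.
Qed.

Lemma Ehlpp_cvg_dir :
  ((\int[Q]_S hlpp S (0%R, 0%R) ((r * x)%R, (r * t)%R)) * (r^-1)%:E)%E
    @[r --> +oo] --> (g * Num.sqrt (x * t))%:E.
Proof.
have [k1 k2] := hyp_squeeze_gt0.
have s0 : 0 < Num.sqrt (x * t) by rewrite sqrtr_gt0 mulr_gt0.
apply: cvg_trans (cvg_scale s0 Ehlpp_cvg); apply: near_eq_cvg; near=> r.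
have r0 : 0 < r by near: r; apply: nbhs_pinfty_gt; rewrite num_real.
rewrite -hyp_squeeze_diag -hyp_squeeze0 (integral_hlpp_aff Qvoid)//.
- exact: hyp_squeeze_area.
- by rewrite /= mulr_ge0// ltW.
- by rewrite /= mulr_ge0// ltW.
Unshelve. all: by end_near. Qed.

End Direction.

End AlmostSure.

(** * Transfer to the marked Poisson process *)

Section NonMeasurable.
Import HBNNSimple.

Lemma ge0_integral_ae_eq d (T : measurableType d) (R : realType) (P : measure T R)
    (f h : T -> \bar R) :
  (forall w, 0 <= f w)%E -> (forall w, 0 <= h w)%E -> {ae P, forall w, f w = h w} ->
  (\int[P]_w f w = \int[P]_w h w)%E.
Proof.
(* No measurability of [f] is assumed: a simple function below [f] is cut down to [0]
   on the exceptional null set, which puts it below [h] without changing its integral. *)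
have key (u v : T -> \bar R) : (forall w, 0 <= u w)%E -> (forall w, 0 <= v w)%E ->
    {ae P, forall w, u w = v w} -> (\int[P]_w u w <= \int[P]_w v w)%E.
  move=> u0 v0 [N [mN N0 uvN]].
  rewrite ge0_integralE//; apply: ge_ereal_sup => _ [s su <-].
  have mNC : measurable (~` N) by exact: measurableC.
  have pE w : proj_nnsfun s mNC w = s w * \1_(~` N) w by [].
  have -> : sintegral P s = sintegral P (proj_nnsfun s mNC).
    rewrite -!integralT_nnsfun; apply: ge0_ae_eq_integral => //.
    - by apply/measurable_EFinP.
    - by apply/measurable_EFinP.
    - by move=> w _; rewrite lee_fin.
    - by move=> w _; rewrite lee_fin.
    exists N; split => // w /= nw; apply: contrapT => Nw; apply: nw => _.
    transitivity (s w * \1_(~` N) w)%:E; last by rewrite -pE.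
    by rewrite indicE mem_set// mulr1.
  rewrite ge0_integralE//; apply: ereal_sup_ubound; exists (proj_nnsfun s mNC) => // w.
  rewrite patch_setT pE indicE; have [wN|wN] := boolP (w \in ~` N); last by rewrite mulr0 v0.
  rewrite mulr1; have := su w; rewrite patch_setT.
  suff -> : u w = v w by [].
  by apply: contrapT => uv; move: wN; rewrite in_setE; apply; exact: uvN.
move=> f0 h0 fh; apply/eqP; rewrite eq_le !key//.
by apply: ae_imp fh => w ->.
Qed.

End NonMeasurable.

(** * Bounds and tail sums of the distribution function *)

Lemma cdf_bounds (R : realType) (F : R -> R) : positive_cdf F -> forall x, 0 <= F x <= 1.
Proof.
move=> [Fnd [_ [FN [FP _]]]] x; apply/andP; split; rewrite leNgt; apply/negP => h.
  have : \forall y \near -oo, F x < F y by apply: cvgr_gt FN _ h.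
  move=> H; have [y [/= h1 h2]] : exists y, F x < F y /\ y <= x.
    near (-oo : set_system R) => y; exists y; split; near: y => //.
    by apply: nbhs_ninfty_le; rewrite num_real.
  by move: h1; rewrite ltNge Fnd.
have : \forall y \near +oo, F y < F x by apply: cvgr_lt FP _ h.
move=> H; have [y [/= h1 h2]] : exists y, F y < F x /\ x <= y.
  near (+oo : set_system R) => y; exists y; split; near: y => //.
  by apply: nbhs_pinfty_ge; rewrite num_real.
by move: h1; rewrite ltNge Fnd.
Unshelve. all: by end_near. Qed.

(** Integral comparison for a nonincreasing function: the term at [j + 1] is at most the integral
    over [[j, j + 1)], and the term at 0 is added separately. *)
Lemma sum_sqrt_tail (R : realType) (F : R -> R) :
  {homo F : x y / x <= y} -> (forall x, 0 <= F x <= 1) ->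
  (\int[lebesgue_measure]_(x in `[0%R, +oo[) (Num.sqrt (1 - F x))%:E < +oo)%E ->
  (\sum_(0 <= j <oo) (Num.sqrt (1 - F j%:R))%:E < +oo)%E.
Proof.
move=> Fnd F01 Fint; pose s x := Num.sqrt (1 - F x).
have s0 x : 0 <= s x by exact: sqrtr_ge0.
have snd x y : x <= y -> s y <= s x by move=> xy; rewrite ler_wsqrtr// lerD2l lerN2 Fnd.
apply: (@le_lt_trans _ _ ((s 0)%:E + \int[lebesgue_measure]_(x in `[0%R, +oo[) (s x)%:E)%E).
  apply: lime_le; first by apply: is_cvg_nneseries => n _ _; rewrite lee_fin s0.
  apply: nearW => -[|n].
    by rewrite big_geq// adde_ge0 ?lee_fin// integral_ge0// => x _; rewrite lee_fin.
  rewrite big_nat_recl//; apply: leeD => //.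
  have ms : measurable_fun (`[0%R, +oo[%classic : set R) s.
    apply: nonincreasing_measurable => //; exact: snd.
  pose I (j : nat) : set R := `[j%:R, j.+1%:R[%classic.
  pose f j x := (s j.+1%:R * \1_(I j) x)%:E.
  have mI j : measurable (I j) by exact: measurable_itv.
  have mf j : measurable_fun (`[0%R, +oo[%classic : set R) (f j).
    by apply/measurable_EFinP; apply: measurable_funM => //; exact: measurable_indic.
  have mind j : measurable_fun (`[0%R, +oo[%classic : set R) (fun x => (\1_(I j) x : R)%:E).
    by apply/measurable_EFinP; exact: measurable_indic.
  have f0 j x : (0 <= f j x)%E by rewrite lee_fin mulr_ge0.
  apply: (@le_trans _ _ (\int[lebesgue_measure]_(x in `[0%R, +oo[) (\sum_(0 <= j < n) f j x))%E).
    rewrite ge0_integral_sum//; apply: lee_sum => j _.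
    rewrite /f; under eq_integral do rewrite EFinM.
    rewrite ge0_integralZl_EFin//; last exact: mind.
    rewrite integral_indic//; last exact: mI.
    have -> : I j `&` `[0%R, +oo[ = I j.
      apply/seteqP; split => x /=; first by move=> [].
      rewrite /I /= !in_itv /= andbT => /andP[h1 h2]; split; first by rewrite h1.
      by apply: le_trans h1.
    have lI : lebesgue_measure (I j) = 1%:E.
      rewrite /I lebesgue_measure_itv /= lte_fin ltr_nat ltnSn -EFinB -natr1.
      by rewrite addrAC subrr add0r.
    apply: (@le_trans _ _ ((s j.+1%:R)%:E * lebesgue_measure (I j))%E); last by [].
    by rewrite lI mule1.
  apply: ge0_le_integral => //.
  - by move=> x _; apply: sume_ge0 => j _.
  - by apply: emeasurable_sum.
  - by apply/measurable_EFinP.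
  move=> x; rewrite /= in_itv /= andbT => x0; rewrite sumEFin lee_fin.
  have /andP[t1 t2] := truncn_itv x0; set k := Num.truncn x in t1 t2.
  have off j : j != k -> s j.+1%:R * \1_(I j) x = 0.
    move=> jk; rewrite indicE memNset ?mulr0// /I /= in_itv /= => /andP[h1 h2].
    have jk1 : (j < k.+1)%N by rewrite -(ltr_nat R); exact: le_lt_trans h1 t2.
    have jk2 : (k < j.+1)%N by rewrite -(ltr_nat R); exact: le_lt_trans t1 h2.
    by case/negP: jk; rewrite eqn_leq -ltnS jk1 -ltnS jk2.
  have [kn|kn] := ltnP k n.
    rewrite (bigD1_seq k) ?mem_index_iota ?iota_uniq//= big1 ?addr0; last by move=> j; exact: off.
    apply: (@le_trans _ _ (s k.+1%:R)); last by apply: snd; exact: ltW.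
    by rewrite ler_piMr// indicE lern1 leq_b1.
  rewrite big_nat big1// => j /andP[_ jn]; apply: off.
  by rewrite neq_ltn (leq_trans jn kn).
by rewrite lte_add_pinfty// ltry.
Qed.

Lemma has_card0 (R : realType) (S : set (mpoint R)) : has_card S 0 <-> S = set0.
Proof.
split=> [[s [_ [/size0nil -> <-]]]|->]; first by apply/seteqP; split.
by exists [::]; split => //; split => //; apply/seteqP; split.
Qed.

Section Transfer.
Context (R : realType) d (T : measurableType d) (P : probability T R).
Variables (F : R -> R) (pts : T -> set (mpoint R)).
Hypothesis pppF : marked_PPP P F pts.

Lemma measurable_pts : measurable_fun setT (pts : T -> conf R).
Proof.
apply: measurable_to_conf => s; elim: s => [|B s IH].
  by rewrite void_nil preimage_setT.
rewrite -cat1s void_cat preimage_setI; apply: measurableI => //.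
have -> : pts @^-1` void [:: B] = [set w | has_card (box_set B `&` pts w) 0].
  apply/seteqP; split => w /=; rewrite has_card0.
    by move/voidP; apply; rewrite mem_head.
  by move=> h; apply/voidP => C; rewrite mem_seq1 => /eqP ->.
exact: pppF.1.
Qed.

Definition pts_mfun : {mfun T >-> conf R} := mfun_Sub (mem_set measurable_pts).

Definition law : probability (conf R) R := distribution P pts_mfun.

(** All prescribed counts are 0, where the Poisson weight is [exp (- m)]; the product becomes the
    exponential of a sum. *)
Lemma law_void (s : seq (box R)) : boxes_ok s -> pairwise (@disjb R) s ->
  law (void s) = (expR (- \sum_(B <- s) box_mean F B))%:E.
Proof.
move=> sok sd; have [_ ppp] := pppF.
have := ppp s (nseq (size s) 0%N); rewrite size_nseq => /(_ erefl) H.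
rewrite -[LHS]/(P (pts @^-1` void s)).
have -> : pts @^-1` void s = [set w | forall i, (i < size s)%N ->
    has_card (box_set (nth (dflt_box R) s i) `&` pts w) (nth 0%N (nseq (size s) 0%N) i)].
  apply/seteqP; split => w /=.
    by move=> /voidP h i is_; rewrite nth_nseq is_ has_card0; apply: h; exact: mem_nth.
  move=> h; apply/voidP => B /(nthP (dflt_box R))[i is_ <-].
  by have := h i is_; rewrite nth_nseq is_ has_card0.
rewrite H.
- congr (_%:E); rewrite -sumrN expR_sum (big_nth (dflt_box R)) big_mkord.
  apply: eq_bigr => i _; rewrite nth_nseq if_same /Defs.poisson_pmf expr0 fact0.
  by rewrite mulr1 divr1.
- by move=> i is_; apply: sok; exact: mem_nth.
- move=> i j ij js; apply/disjbP.
  by have /(pairwiseP (dflt_box R)) := sd; apply => //; exact: ltn_trans ij js.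
Qed.

Lemma ae_law (p : conf R -> Prop) :
  {ae law, forall S, p S} -> {ae P, forall w, p (pts w)}.
Proof.
move=> [N [mN N0 pN]]; exists (pts @^-1` N); split.
- by rewrite -[X in measurable X]setTI; exact: measurable_pts.
- exact: N0.
- by move=> w nw; apply: pN.
Qed.

Lemma integral_law (f : conf R -> \bar R) : measurable_fun setT f ->
  (forall S, 0 <= f S)%E -> (\int[law]_S f S = \int[P]_w f (pts w))%E.
Proof.
move=> mf f0; rewrite /law /= /distribution.
by rewrite (ge0_integral_pushforward (measurable_pts)).
Qed.

Hypothesis Fnd : {homo F : x y / x <= y}.
Hypothesis F01 : forall x, 0 <= F x <= 1.

(** The null set comes from the ties and is the same for all endpoints, as limits over uncountably
    many [r] demand. *)
Lemma ae_LPP_hlpp : {ae P, forall w, forall p q, LPP (pts w) p q = hlpp (pts w) p q}.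
Proof.
have := ae_law (ae_noties Fnd F01 law_void).
by apply: ae_imp => w nt p q; exact: LPP_hlpp.
Qed.

Lemma LPP_ge0 (S : set (mpoint R)) p q : (0 <= LPP S p q)%E.
Proof. by apply: ereal_sup_ubound; exists [::] => //; rewrite big_nil. Qed.

(** [LPP] is not shown to be measurable in [w]; its integral is compared with that of [hlpp] through
    [ge0_integral_ae_eq]. *)
Lemma integral_LPP (p q : R * R) : p.1 <= q.1 -> p.2 <= q.2 ->
  (\int[P]_w LPP (pts w) p q = \int[law]_S hlpp S p q)%E.
Proof.
move=> pq1 pq2; rewrite integral_law; last by move=> S; exact: hlpp_ge0.
- apply: ge0_integral_ae_eq => [w|w|]; [exact: LPP_ge0|exact: hlpp_ge0|].
  by apply: ae_imp ae_LPP_hlpp => w.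
- exact: measurable_hlpp.
Qed.

Lemma gammaF_gam : gammaF P pts = gam law.
Proof.
rewrite /gammaF /gam; congr ereal_sup; apply/seteqP; split => y [n /= n0 <-];
  by exists n => //; rewrite integral_LPP.
Qed.

End Transfer.

Theorem theorem1p1 (R : realType) (d : measure_display) (T : measurableType d)
    (P : probability T R) (F : R -> R) (pts : T -> set (mpoint R)) :
  positive_cdf F ->
  marked_PPP P F pts ->
  (\int[lebesgue_measure]_(x in `[0%R, +oo[) (Num.sqrt (1 - F x))%:E < +oo)%E ->
  (gammaF P pts < +oo)%E /\
  (forall x t : R, 0 < x -> 0 < t ->
    ((\int[P]_w LPP (pts w) (0%R, 0%R) ((r * x)%R, (r * t)%R)) * (r^-1)%:E)%E
      @[r --> +oo] --> (gammaF P pts * (Num.sqrt (x * t))%:E)%E) /\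
  (forall x t : R, 0 < x -> 0 < t ->
    {ae P, forall w, (LPP (pts w) (0%R, 0%R) ((r * x)%R, (r * t)%R) * (r^-1)%:E)%E
      @[r --> +oo] --> (gammaF P pts * (Num.sqrt (x * t))%:E)%E}).
Proof.
move=> cdfF pppF Fint.
have [Fnd _] := cdfF; have F01 := cdf_bounds cdfF.
have Fsum := sum_sqrt_tail Fnd F01 Fint.
have Qvoid := law_void pppF.
rewrite (gammaF_gam pppF Fnd F01).
have fin := gam_fin Fnd F01 Qvoid Fsum.
have gE x t : (gam (law pppF) * (Num.sqrt (x * t))%:E)%E =
    (fine (gam (law pppF)) * Num.sqrt (x * t))%:E by rewrite EFinM fineK.
split; first by rewrite -(fineK fin) ltry.
split=> x t x0 t0; rewrite gE.
  apply: cvg_trans (Ehlpp_cvg_dir Fnd F01 Qvoid Fsum x0 t0); apply: near_eq_cvg; near=> r.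
  have r0 : 0 < r by near: r; apply: nbhs_pinfty_gt; rewrite num_real.
  by rewrite (integral_LPP pppF Fnd F01)//= mulr_ge0// ltW.
have := ae_law (ae_hlpp_cvg_dir Fnd F01 Qvoid Fsum x0 t0).
apply: filterS2 (ae_LPP_hlpp pppF Fnd F01) => w LE.
by under eq_fun do rewrite -LE.
Unshelve. all: by end_near. Qed.
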